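(* Let $M$ be a connected, complete Riemannian manifold of dimension $n\ge 2$ with constant sectional curvature $K\neq 0$. Let $U\subset M$ be an open subset on which there is a smooth orthonormal frame $X_1,\dots,X_n$, and let $f:U\to\mathbb{C}$ be a smooth function with $\Delta f=-\lambda f$ on $U$ for some $\lambda\in\mathbb{C}$. Put $$\theta=\sum_{i=1}^nX_i\otimes X_i,\qquad \Lambda=\sum_{\mu\in\mathrm{Sym}_n}(-1)^{\mu}X_{\mu(1)}\otimes\cdots\otimes X_{\mu(n)} .$$ Then for every integer $k\ge 0$ and every $\sigma\in\mathrm{Sym}_{2k+n}$, $$(\nabla^{2k+n}f)\big(\sigma(\theta^{\otimes k}\otimes\Lambda)\big)=0 .$$
   Context: $\nabla$ is the Levi-Civita connection. Iterated covariant derivatives are defined by $\nabla^1 f=df$ and $(\nabla^m f)(Z_1,\dots,Z_m)=(\nabla_{Z_1}(\nabla^{m-1}f))(Z_2,\dots,Z_m)$; $(\nabla^m f)(\cdot)$ is extended linearly to sections of the $m$-th tensor power of the complexified tangent bundle, so $(\nabla^mf)(Z_1\otimes\cdots\otimes Z_m)=(\nabla^mf)(Z_1,\dots,Z_m)$. $\Delta f=\sum_i(\nabla^2f)(X_i,X_i)$ is the Laplace-Beltrami operator. $\mathrm{Sym}_r$ is the symmetric group on $\{1,\dots,r\}$, $(-1)^\mu$ is the sign of $\mu$, and $\mathrm{Sym}_r$ acts on $r$-tensors by $\sigma(v_1\otimes\cdots\otimes v_r)=v_{\sigma^{-1}(1)}\otimes\cdots\otimes v_{\sigma^{-1}(r)}$.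 *)

(* Defs.v *)
(* Smooth manifolds are given by atlases; tangent vectors at a point are
   derivations of the algebra of germs of smooth functions at that point. *)
From HB Require Import structures.
From mathcomp Require Import all_boot all_order all_algebra fingroup perm.
From mathcomp Require Import all_classical all_reals all_analysis.
From mathcomp Require Import complex.

Set Implicit Arguments.
Unset Strict Implicit.
Unset Printing Implicit Defensive.

Import Order.TTheory GRing.Theory Num.Theory.
Import numFieldNormedType.Exports.

Local Open Scope classical_set_scope.
Local Open Scope ring_scope.

Section Euclidean.
Variables (R : realType) (n : nat).

Fixpoint Ck (k : nat) (W : set 'rV[R]_n) (h : 'rV[R]_n -> R) : Prop :=
  (forall x, W x -> {for x, continuous h}) /\
  match k with
  | 0 => True
  | k'.+1 => forall i : 'I_n,
      (forall x, W x -> derivable h x (delta_mx 0 i)) /\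
      Ck k' W (fun x => 'D_(delta_mx 0 i) h x)
  end.

Definition Cinf (W : set 'rV[R]_n) (h : 'rV[R]_n -> R) : Prop :=
  forall k, Ck k W h.

End Euclidean.

(* A homeomorphism from the open set [dom] onto the open set [fwd @` dom];
   the values of [fwd] and [bwd] outside these two sets are irrelevant. *)
Record chart (R : realType) (n : nat) (M : topologicalType) := Chart {
  dom : set M;
  fwd : M -> 'rV[R]_n;
  bwd : 'rV[R]_n -> M;
  dom_open : open dom;
  fwd_open : open (fwd @` dom);
  fwdK : forall p, dom p -> bwd (fwd p) = p;
  fwd_continuous : forall p, dom p -> {for p, continuous fwd};
  bwd_continuous : forall x, (fwd @` dom) x -> {for x, continuous bwd}
}.

Record smoothManifold (R : realType) (n : nat) := SmoothManifold {
  carrier :> topologicalType;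
  carrier_hausdorff : hausdorff_space carrier;
  carrier_second_countable : @second_countable carrier;
  atlas : set (chart R n carrier);
  atlas_cover : forall p : carrier, exists2 c, atlas c & dom c p;
  atlas_smooth : forall c c', atlas c -> atlas c' -> forall i : 'I_n,
    Cinf (fwd c @` (dom c `&` dom c')) (fun x => fwd c' (bwd c x) 0 i)
}.

Section Tangent.
Variables (R : realType) (n : nat) (M : smoothManifold R n).

Definition smooth_on (V : set M) (h : M -> R) : Prop :=
  forall c, atlas c -> Cinf (fwd c @` (V `&` dom c)) (h \o bwd c).

Definition smooth_at (p : M) (h : M -> R) : Prop :=
  exists V : set M, [/\ open V, V p & smooth_on V h].

(* A derivation of the algebra of germs at p of smooth functions, encoded as a
   functional on all functions; the first clause makes the encoding unique. *)
Definition is_derivation (p : M) (v : (M -> R) -> R^o) : Prop :=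
  [/\ forall h, ~ smooth_at p h -> v h = 0,
      forall h1 h2, smooth_at p h1 -> smooth_at p h2 ->
        (\forall q \near p, h1 q = h2 q) -> v h1 = v h2,
      forall (a : R) h1 h2, smooth_at p h1 -> smooth_at p h2 ->
        v (fun q => a * h1 q + h2 q) = a * v h1 + v h2 &
      forall h1 h2, smooth_at p h1 -> smooth_at p h2 ->
        v (fun q => h1 q * h2 q) = v h1 * h2 p + h1 p * v h2].

Definition derivations (p : M) : {pred (M -> R) -> R^o} :=
  [pred v | `[< is_derivation p v >]].

Lemma derivations_submod (p : M) : submod_closed (derivations p).
Proof.
split=> [|a u v].
  apply/asboolP; split=> [h _|h1 h2 _ _ _|a h1 h2 _ _|h1 h2 _ _] //.
    by rewrite mulr0 addr0.
  by rewrite mul0r mulr0 addr0.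
move=> /asboolP[u0 ug uL uM] /asboolP[v0 vg vL vM]; apply/asboolP; split.
- by move=> h nh; rewrite !fctE u0 // v0 // scaler0 addr0.
- by move=> h1 h2 s1 s2 e; rewrite !fctE (ug _ _ s1 s2 e) (vg _ _ s1 s2 e).
- move=> b h1 h2 s1 s2; rewrite !fctE uL // vL // /GRing.scale /=.
  by rewrite !mulrDr addrACA mulrCA.
- move=> h1 h2 s1 s2; rewrite !fctE uM // vM // /GRing.scale /=.
  by rewrite mulrDr mulrDl addrACA mulrA mulrDr mulrCA.
Qed.

HB.instance Definition _ (p : M) :=
  GRing.isSubmodClosed.Build R ((M -> R) -> R^o) (derivations p)
    (derivations_submod p).

Record tangent (p : M) := Tangent {
  tangent_val :> (M -> R) -> R^o;
  _ : tangent_val \in derivations p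
}.

HB.instance Definition _ (p : M) := [isSub for @tangent_val p].
HB.instance Definition _ (p : M) := [Choice of tangent p by <:].
HB.instance Definition _ (p : M) :=
  [SubChoice_isSubLmodule of tangent p by <:].

(* The tangent vector at p acting as F on functions that are smooth at p (the
   zero vector if F is not a derivation). *)
Definition tangent_of (p : M) (F : (M -> R) -> R) : tangent p :=
  insubd (0 : tangent p) (fun h => if `[< smooth_at p h >] then F h else 0).

(* Vector fields on an open set V are restrictions to V of elements of [vfield];
   nothing is required outside V. *)
Definition vfield := forall p : M, tangent p.

Definition smooth_vfield (V : set M) (X : vfield) : Prop :=
  forall (W : set M) (h : M -> R), open W -> smooth_on W h ->
    smooth_on (V `&` W) (fun q => X q h).

Definition bracket (X Y : vfield) : vfield := fun p =>
  tangent_of p (fun h => X p (fun q => Y q h) - Y p (fun q => X q h)).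

End Tangent.

Record riemannianManifold (R : realType) (n : nat) := RiemannianManifold {
  rcarrier :> smoothManifold R n;
  metric : forall p : rcarrier, tangent p -> tangent p -> R;
  metricC : forall p (u v : tangent p), metric u v = metric v u;
  metricP : forall p (a : R) (u v w : tangent p),
    metric (a *: u + v) w = a * metric u w + metric v w;
  metric_gt0 : forall p (u : tangent p), u != 0 -> 0 < metric u u;
  metric_smooth : forall (V : set rcarrier) (X Y : vfield rcarrier), open V ->
    smooth_vfield V X -> smooth_vfield V Y ->
    smooth_on V (fun q => metric (X q) (Y q))
}.

Section Completeness.
Variables (R : realType) (n : nat) (M : riemannianManifold R n).

(* The restriction of c to [0, 1] is a smooth curve, i.e. c is smooth on some
   open interval containing [0, 1]. *)
Definition smooth_curve (c : R -> M) : Prop :=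
  exists2 e : R, 0 < e &
    forall t, - e < t < 1 + e ->
      {for t, continuous c} /\
      forall phi, atlas phi -> dom phi (c t) -> forall (i : 'I_n) (k : nat),
        derivable (derive1n k (fun s => fwd phi (c s) 0 i)) t 1.

Definition velocity (c : R -> M) (t : R) : tangent (c t) :=
  tangent_of (c t) (fun h => derive1 (h \o c) t).

Definition curve_length (c : R -> M) : \bar R :=
  (\int[@lebesgue_measure R]_(t in `[0%R, 1%R])
     (Num.sqrt (metric (velocity c t) (velocity c t)))%:E)%E.

(* s is a list of smooth curves whose concatenation joins p to q. *)
Fixpoint joins (p : M) (s : seq (R -> M)) (q : M) : Prop :=
  match s with
  | [::] => p = q
  | c :: s' => [/\ smooth_curve c, c 0 = p & joins (c 1) s' q]
  end.

Definition riemannian_dist (p q : M) : \bar R :=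
  ereal_inf [set (\sum_(c <- s) curve_length c)%E | s in [set s | joins p s q]].

Definition complete_manifold : Prop :=
  forall u : nat -> M,
    (forall e : R, 0 < e -> exists N, forall i j, (N <= i)%N -> (N <= j)%N ->
       (riemannian_dist (u i) (u j) < e%:E)%E) ->
    exists l : M, forall e : R, 0 < e -> exists N, forall i, (N <= i)%N ->
       (riemannian_dist (u i) l < e%:E)%E.

End Completeness.

Section Connection.
Variables (R : realType) (n : nat) (M : riemannianManifold R n).

(* [nabla p v Y] is the covariant derivative at p in the direction v of a vector
   field Y that is smooth near p. *)
Definition connection := forall p : M, tangent p -> vfield M -> tangent p.

Implicit Types (nabla : connection) (X Y Z : vfield M) (V : set M).

Definition covd nabla X Y : vfield M := fun p => nabla p (X p) Y.

Definition affine_connection nabla : Prop :=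
  [/\ forall V X Y, open V -> smooth_vfield V X -> smooth_vfield V Y ->
        smooth_vfield V (covd nabla X Y),
      forall V Y p (a : R) (u v : tangent p), open V -> smooth_vfield V Y ->
        V p -> nabla p (a *: u + v) Y = a *: nabla p u Y + nabla p v Y,
      forall V Y Z p (v : tangent p), open V -> smooth_vfield V Y ->
        smooth_vfield V Z -> V p ->
        nabla p v (fun q => Y q + Z q) = nabla p v Y + nabla p v Z,
      forall V (h : M -> R) Y p (v : tangent p), open V -> smooth_on V h ->
        smooth_vfield V Y -> V p ->
        nabla p v (fun q => h q *: Y q) = v h *: Y p + h p *: nabla p v Y &
      forall V Y Z p (v : tangent p), open V -> smooth_vfield V Y ->
        smooth_vfield V Z -> V p -> (forall q, V q -> Y q = Z q) ->
        nabla p v Y = nabla p v Z].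

Definition torsion_free nabla : Prop :=
  forall V X Y p, open V -> smooth_vfield V X -> smooth_vfield V Y -> V p ->
    covd nabla X Y p - covd nabla Y X p = bracket X Y p.

Definition metric_compatible nabla : Prop :=
  forall V Y Z p (v : tangent p), open V -> smooth_vfield V Y ->
    smooth_vfield V Z -> V p ->
    v (fun q => metric (Y q) (Z q)) =
      metric (nabla p v Y) (Z p) + metric (Y p) (nabla p v Z).

Definition levi_civita nabla : Prop :=
  [/\ affine_connection nabla, torsion_free nabla & metric_compatible nabla].

Definition curvature nabla X Y Z : vfield M := fun p =>
  covd nabla X (covd nabla Y Z) p - covd nabla Y (covd nabla X Z) p
  - covd nabla (bracket X Y) Z p.

(* Meaningful when X p and Y p are linearly independent: the curvature of the
   plane they span. *)
Definition sectional_curvature nabla X Y (p : M) : R :=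
  metric (curvature nabla X Y Y p) (X p) /
  (metric (X p) (X p) * metric (Y p) (Y p) - metric (X p) (Y p) ^+ 2).

Definition constant_sectional_curvature nabla (K : R) : Prop :=
  forall V X Y p, open V -> smooth_vfield V X -> smooth_vfield V Y -> V p ->
    (forall a b : R, a *: X p + b *: Y p = 0 -> a = 0 /\ b = 0) ->
    sectional_curvature nabla X Y p = K.

Definition orthonormal_frame V (X : 'I_n -> vfield M) : Prop :=
  [/\ forall i, smooth_vfield V (X i),
      forall p i j, V p -> metric (X i p) (X j p) = (i == j)%:R &
      forall p (v : tangent p), V p ->
        exists a : 'I_n -> R, v = \sum_(i < n) a i *: X i p].

Definition csmooth_on V (f : M -> R[i]) : Prop :=
  smooth_on V (fun q => complex.Re (f q)) /\
  smooth_on V (fun q => complex.Im (f q)).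

Definition cderiv (p : M) (v : tangent p) (f : M -> R[i]) : R[i] :=
  Complex (v (fun q => complex.Re (f q))) (v (fun q => complex.Im (f q))).

(* (nabla^m f)(Z_1, ..., Z_m), where nabla^0 f = f and
   (nabla_Z T)(Y_1, ..., Y_r) = Z (T (Y_1, ..., Y_r))
                                - sum_i T (Y_1, ..., nabla_Z Y_i, ..., Y_r). *)
Fixpoint nabla_iter nabla (f : M -> R[i]) (m : nat) :
    ('I_m -> vfield M) -> M -> R[i] :=
  match m with
  | 0 => fun _ => f
  | r.+1 => fun (Z : 'I_r.+1 -> vfield M) p =>
      let Z1 := Z ord0 in
      let Y : 'I_r -> vfield M := fun j : 'I_r => Z (lift ord0 j) in
      cderiv (Z1 p) (nabla_iter nabla f Y) -
      \sum_(i < r) nabla_iter nabla f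
        (fun j : 'I_r => if j == i then covd nabla Z1 (Y j) else Y j) p
  end.

Definition laplacian nabla (X : 'I_n -> vfield M) (f : M -> R[i]) (p : M) :
    R[i] :=
  \sum_(i < n) nabla_iter nabla f (fun _ : 'I_2 => X i) p.

(* Sections of the r-th tensor power of the complexified tangent bundle, as
   formal sums of terms a * (Z_1 (x) ... (x) Z_r); two formal sums may represent
   the same section. *)
Definition tensor (r : nat) := seq (R[i] * ('I_r -> vfield M)).

Definition tensor_one : tensor 0 := [:: (1, fun _ p => 0)].

Definition tensor_mul r s (S : tensor r) (T : tensor s) : tensor (r + s) :=
  [seq (a.1 * b.1, fun j : 'I_(r + s) =>
          match fintype.split j with inl i => a.2 i | inr i => b.2 i end)
  | a <- S, b <- T].

Fixpoint tensor_exp r (T : tensor r) (k : nat) : tensor (k * r) :=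
  match k with
  | 0 => tensor_one
  | k'.+1 => tensor_mul T (tensor_exp T k')
  end.

Definition tensor_perm r (s : 'S_r) (T : tensor r) : tensor r :=
  [seq (a.1, fun j : 'I_r => a.2 ((s^-1)%g j)) | a <- T].

Definition nabla_tensor nabla (f : M -> R[i]) r (T : tensor r) (p : M) : R[i] :=
  \sum_(a <- T) a.1 * nabla_iter nabla f a.2 p.

Definition theta (X : 'I_n -> vfield M) : tensor 2 :=
  [seq (1, fun _ : 'I_2 => X i) | i <- enum 'I_n].

Definition Lambda (X : 'I_n -> vfield M) : tensor n :=
  [seq ((-1) ^+ odd_perm mu, fun j : 'I_n => X (mu j)) | mu <- enum 'S_n].

End Connection.

(* Main.v *)
(* Commuting two neighbouring arguments of an iterated covariant derivative
   costs, by the Ricci identity and the constancy of the curvature, only terms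
   in which a derivative of order two less is contracted against a trace of the
   original tensor.  The tensors built from theta's and one Lambda are stable
   under permutations and, up to a factor, under such traces: a trace of two
   slots of Lambda vanishes, and every other trace merges or deletes a theta.
   By induction on the order the contraction is therefore invariant under all
   permutations of the slots, whereas transposing two slots of Lambda changes
   its sign; so it vanishes. *)
Require Import Defs.
From mathcomp Require Import all_boot all_order all_algebra fingroup perm.
From mathcomp Require Import all_classical all_reals all_analysis.
From mathcomp Require Import complex.
From mathcomp Require Import ring lra.

Set Implicit Arguments.
Unset Strict Implicit.
Unset Printing Implicit Defensive.

Import Order.TTheory GRing.Theory Num.Theory.
Import numFieldNormedType.Exports.

Local Open Scope classical_set_scope.
Local Open Scope ring_scope.

(** * Smooth functions, tangent vectors and brackets *)

Section SmoothFunctions.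
Variables (R : realType) (n : nat).
Implicit Types (W : set 'rV[R]_n) (h : 'rV[R]_n -> R).

(** Tensors are handled through their components in the frame, as functions of words in the frame
    indices. The obstacle is that [nabla_iter] feeds the fields [covd nabla Z1 (Y j)] back into
    itself, so its values on frame fields alone do not satisfy a closed recursion. Its values on all
    smooth fields are therefore expressed as contractions of components obtained by iterating
    [cov_deriv]. An interchange behind a prefix u of further derivatives requires the Ricci identity
    to be differentiated along u. The curvature form of constant curvature is parallel, so each
    differentiation reproduces the identity, with the curvature acting only on the slots to the
    right of the pair. For traces, the tensor is encoded by a word of variables. Removing or merging
    a theta leaves a variable that occurs nowhere but is still summed; it contributes a factor n, so
    the set of variables stays fixed during the induction. *)

Lemma Ck_sub k W W' h : W' `<=` W -> Ck k W h -> Ck k W' h.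
Proof.
elim: k h => [|k IH] h sub /= [hc hd]; split => //.
- by move=> x /sub; exact: hc.
- by move=> x /sub; exact: hc.
- by move=> i; have [d c] := hd i; split; [move=> x /sub; exact: d|exact: IH].
Qed.

Lemma near_eq_open (T : topologicalType) (S : Type) (W : set T) (h1 h2 : T -> S) x :
  open W -> W x -> (forall y, W y -> h1 y = h2 y) -> \forall y \near x, h1 y = h2 y.
Proof.
move=> oW Wx e; have : nbhs x W by exact: open_nbhs_nbhs.
by apply: filterS => y; exact: e.
Qed.

Lemma continuous_ext_open (T S : topologicalType) (W : set T) (f g : T -> S) x :
  open W -> W x -> (forall y, W y -> f y = g y) ->
  {for x, continuous f} -> {for x, continuous g}.
Proof.
move=> oW Wx e; rewrite /prop_for /continuous_at /= -(e x Wx) => fc.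
apply: cvg_trans fc; apply: near_eq_cvg; exact: near_eq_open oW Wx e.
Qed.

Lemma Ck_ext k W h1 h2 : open W -> (forall x, W x -> h1 x = h2 x) ->
  Ck k W h1 -> Ck k W h2.
Proof.
elim: k h1 h2 => [|k IH] h1 h2 oW e /= [hc hd]; split => //.
- by move=> x Wx; apply: (continuous_ext_open oW Wx e); exact: hc.
- by move=> x Wx; apply: (continuous_ext_open oW Wx e); exact: hc.
- move=> i; have [d c] := hd i; split.
    by move=> x Wx; apply: near_eq_derivable (d x Wx); exact: near_eq_open oW Wx e.
  apply: IH c => // x Wx; apply: near_eq_derive; exact: near_eq_open oW Wx e.
Qed.

(** Serves the product rule, where an undifferentiated factor is used at one order less. *)
Lemma Ck_pred k W h : Ck k.+1 W h -> Ck k W h.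
Proof.
elim: k h => [|k IH] h [hc hd]; split=> // i.
by have [d c] := hd i; split=> //; exact: IH.
Qed.

Lemma Ck_cst k W (a : R) : Ck k W (fun=> a).
Proof.
elim: k a => [|k IH] a; split => //; try by move=> x _; exact: cst_continuous.
move=> i.
split=> [x _|]; first exact: derivable_cst.
rewrite (_ : (fun x => 'D_(delta_mx 0 i) (fun=> a) x) = fun=> 0); first exact: IH.
by apply/funext => x; exact: derive_cst.
Qed.

Lemma Ck_add k W h1 h2 : open W ->
  Ck k W h1 -> Ck k W h2 -> Ck k W (fun x => h1 x + h2 x).
Proof.
move=> oW; elim: k h1 h2 => [|k IH] h1 h2 [c1 d1] [c2 d2]; split => //.
- by move=> x Wx; exact: (continuousD (c1 _ Wx) (c2 _ Wx)).
- by move=> x Wx; exact: (continuousD (c1 _ Wx) (c2 _ Wx)).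
- move=> i; have [e1 f1] := d1 i; have [e2 f2] := d2 i; split.
    by move=> x Wx; apply: derivableD; [exact: e1|exact: e2].
  apply: Ck_ext (IH _ _ f1 f2) => // x Wx.
  by rewrite -deriveD; [|exact: e1|exact: e2].
Qed.

Lemma Ck_mul k W h1 h2 : open W ->
  Ck k W h1 -> Ck k W h2 -> Ck k W (fun x => h1 x * h2 x).
Proof.
move=> oW; elim: k h1 h2 => [|k IH] h1 h2 C1 C2;
  have [c1 d1] := C1; have [c2 d2] := C2; split => //.
- by move=> x Wx; exact: (continuousM (c1 _ Wx) (c2 _ Wx)).
- by move=> x Wx; exact: (continuousM (c1 _ Wx) (c2 _ Wx)).
- move=> i; have [e1 f1] := d1 i; have [e2 f2] := d2 i; split.
    by move=> x Wx; apply: derivableM; [exact: e1|exact: e2].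
  have := Ck_add oW (IH _ _ (Ck_pred C1) f2) (IH _ _ (Ck_pred C2) f1).
  apply: Ck_ext => // x Wx.
  by rewrite -[LHS]deriveM; [|exact: e1|exact: e2].
Qed.

Variable M : smoothManifold R n.
Implicit Types (V : set M) (f g : M -> R).

(** [bwd c] is assumed continuous only at points of the image of [dom c], so the preimage of [V] is
    cut down to that open set. *)
Lemma open_chart_image V (c : chart R n M) : open V -> open (fwd c @` (V `&` dom c)).
Proof.
move=> oV; rewrite openE => x [p [Vp dp] <-].
have dx : (fwd c @` dom c) (fwd c p) by exists p.
have n1 : nbhs (fwd c p) (fwd c @` dom c).
  by apply: open_nbhs_nbhs; split=> //; exact: fwd_open.
have n2 : nbhs (fwd c p) (bwd c @^-1` V).
  apply: bwd_continuous => //; rewrite fwdK //; exact: open_nbhs_nbhs.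
apply: filterS2 n1 n2 => y [q dq <-]; rewrite /= fwdK // => Vq.
by exists q.
Qed.

Lemma smooth_on_subset V V' f : V' `<=` V -> smooth_on V f -> smooth_on V' f.
Proof.
move=> sub sf c ac k; apply: Ck_sub (sf c ac k).
by apply: image_subset => q [Vq dq]; split=> //; exact: sub.
Qed.

Lemma smooth_on_ext V f g : open V -> (forall q, V q -> f q = g q) ->
  smooth_on V f -> smooth_on V g.
Proof.
move=> oV e sf c ac k; apply: Ck_ext (sf c ac k); first exact: open_chart_image.
by move=> x [q [Vq dq] <-] /=; rewrite fwdK // e.
Qed.

Lemma smooth_on_cst V (a : R) : smooth_on V (fun=> a).
Proof. by move=> c ac k; exact: Ck_cst. Qed.

Lemma smooth_on_add V f g : open V -> smooth_on V f -> smooth_on V g ->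
  smooth_on V (fun q => f q + g q).
Proof.
move=> oV sf sg c ac k; apply: Ck_add (sf c ac k) (sg c ac k).
exact: open_chart_image.
Qed.

Lemma smooth_on_mul V f g : open V -> smooth_on V f -> smooth_on V g ->
  smooth_on V (fun q => f q * g q).
Proof.
move=> oV sf sg c ac k; apply: Ck_mul (sf c ac k) (sg c ac k).
exact: open_chart_image.
Qed.

Lemma smooth_on_opp V f : open V -> smooth_on V f -> smooth_on V (fun q => - f q).
Proof.
move=> oV sf; have := smooth_on_mul oV (smooth_on_cst V (-1)) sf.
by apply: smooth_on_ext => // q _; rewrite mulN1r.
Qed.

Lemma smooth_onB V f g : open V -> smooth_on V f -> smooth_on V g ->
  smooth_on V (fun q => f q - g q).
Proof. by move=> oV sf sg; apply: smooth_on_add => //; exact: smooth_on_opp. Qed.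

Lemma smooth_on_sum V (I : Type) (r : seq I) (F : I -> M -> R) : open V ->
  (forall i, smooth_on V (F i)) -> smooth_on V (fun q => \sum_(i <- r) F i q).
Proof.
move=> oV sF; elim: r => [|i r IH].
  apply: smooth_on_ext (smooth_on_cst V 0) => // q _; by rewrite big_nil.
apply: smooth_on_ext (smooth_on_add oV (sF i) IH) => // q _.
by rewrite big_cons.
Qed.

Lemma smooth_on_at V f p : open V -> V p -> smooth_on V f -> smooth_at p f.
Proof. by move=> oV Vp sf; exists V. Qed.

Lemma smooth_atD p f g : smooth_at p f -> smooth_at p g ->
  smooth_at p (fun q => f q + g q).
Proof.
move=> [V1 [op1 p1 f1]] [V2 [op2 p2 f2]].
exists (V1 `&` V2); split=> //; first exact: openI.
apply: smooth_on_add; first exact: openI.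
  by apply: smooth_on_subset f1 => q [].
by apply: smooth_on_subset f2 => q [].
Qed.

Lemma smooth_atM p f g : smooth_at p f -> smooth_at p g ->
  smooth_at p (fun q => f q * g q).
Proof.
move=> [V1 [op1 p1 f1]] [V2 [op2 p2 f2]].
exists (V1 `&` V2); split=> //; first exact: openI.
apply: smooth_on_mul; first exact: openI.
  by apply: smooth_on_subset f1 => q [].
by apply: smooth_on_subset f2 => q [].
Qed.

Lemma smooth_at_cst p (a : R) : smooth_at p (fun _ : M => a).
Proof. by exists setT; split=> //; [exact: openT|exact: smooth_on_cst]. Qed.

Section TangentVectors.
Variables (p : M) (v : tangent p).

Lemma tangentP : is_derivation p (tangent_val v).
Proof. by case: v => w /= /asboolP. Qed.

Lemma tangent_nonsmooth f : ~ smooth_at p f -> v f = 0.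
Proof. by have [H _ _ _] := tangentP; exact: H. Qed.

Lemma tangent_local V f g : open V -> V p -> smooth_on V f ->
  (forall q, V q -> f q = g q) -> v f = v g.
Proof.
move=> oV Vp sf e; have [_ H _ _] := tangentP; apply: H.
- exact: smooth_on_at sf.
- by apply: (smooth_on_at oV Vp); exact: smooth_on_ext sf.
- exact: near_eq_open oV Vp e.
Qed.

Lemma tangent_linear (a : R) f g : smooth_at p f -> smooth_at p g ->
  v (fun q => a * f q + g q) = a * v f + v g.
Proof. by have [_ _ H _] := tangentP; exact: H. Qed.

Lemma tangentM f g : smooth_at p f -> smooth_at p g ->
  v (fun q => f q * g q) = v f * g p + f p * v g.
Proof. by have [_ _ _ H] := tangentP; exact: H. Qed.

Lemma tangent_cst (a : R) : v (fun=> a) = 0.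
Proof.
have c1 : v (fun=> 1) = 0.
  have := tangentM (smooth_at_cst p 1) (smooth_at_cst p 1).
  by rewrite !mulr1 mul1r => /eqP; rewrite -subr_eq subrr => /eqP <-.
have c0 : v (fun=> 0) = 0.
  have := tangentM (smooth_at_cst p 0) (smooth_at_cst p 0).
  by rewrite !mulr0 mul0r addr0.
have := tangent_linear a (smooth_at_cst p 1) (smooth_at_cst p 0).
by rewrite mulr1 addr0 c1 c0 mulr0 addr0.
Qed.

Lemma tangentD f g : smooth_at p f -> smooth_at p g ->
  v (fun q => f q + g q) = v f + v g.
Proof.
move=> sf sg; have := tangent_linear 1 sf sg; rewrite mul1r => <-.
by congr (tangent_val v _); apply/funext => q; rewrite mul1r.
Qed.

Lemma tangentZ (a : R) f : smooth_at p f -> v (fun q => a * f q) = a * v f.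
Proof.
move=> sf; have := tangent_linear a sf (smooth_at_cst p 0); rewrite tangent_cst addr0 => <-.
by congr (tangent_val v _); apply/funext => q; rewrite addr0.
Qed.

Lemma tangentB f g : smooth_at p f -> smooth_at p g ->
  v (fun q => f q - g q) = v f - v g.
Proof.
move=> sf sg; have := tangent_linear (-1) sg sf.
rewrite mulN1r addrC => <-; congr (tangent_val v _).
by apply/funext => q; rewrite mulN1r addrC.
Qed.

End TangentVectors.

Lemma tangent_sum p (v : tangent p) V (I : Type) (r : seq I) (F : I -> M -> R) :
  open V -> V p -> (forall i, smooth_on V (F i)) ->
  v (fun q => \sum_(i <- r) F i q) = \sum_(i <- r) v (F i).
Proof.
move=> oV Vp sF; elim: r => [|i r IH].
  rewrite big_nil -[RHS](tangent_cst v 0); congr (tangent_val v _).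
  by apply/funext => q; rewrite big_nil.
rewrite big_cons -IH -tangentD; [|exact: smooth_on_at (sF i)|].
  by congr (tangent_val v _); apply/funext => q; rewrite big_cons.
by apply: (smooth_on_at oV Vp); exact: smooth_on_sum.
Qed.

Lemma tangent_addE p (v w : tangent p) f : (v + w) f = v f + w f.
Proof. by []. Qed.

Lemma tangent_oppE p (v : tangent p) f : (- v) f = - v f.
Proof. by []. Qed.

Lemma tangent_scaleE p a (v : tangent p) f : (a *: v) f = a * v f.
Proof. by []. Qed.

Lemma tangent_sumE p (I : Type) (r : seq I) (F : I -> tangent p) f :
  (\sum_(i <- r) F i) f = \sum_(i <- r) F i f.
Proof. by elim: r => [|i r IH]; rewrite ?big_nil // !big_cons tangent_addE IH. Qed.

Lemma tangent_eq p (v w : tangent p) :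
  (forall f, smooth_at p f -> v f = w f) -> v = w.
Proof.
move=> e; apply: val_inj; apply/funext => f /=.
have [sf|nf] := pselect (smooth_at p f); first exact: e.
by rewrite !tangent_nonsmooth.
Qed.

Implicit Types (X Y : vfield M).

Lemma smooth_vfield_at V X f p : open V -> V p -> smooth_vfield V X ->
  smooth_at p f -> smooth_at p (fun q => X q f).
Proof.
move=> oV Vp sX [W [oW Wp sf]]; exists (V `&` W); split=> //; first exact: openI.
exact: sX.
Qed.

Lemma smooth_vfieldE V X f : open V -> smooth_vfield V X -> smooth_on V f ->
  smooth_on V (fun q => X q f).
Proof. by move=> oV sX sf; rewrite -[V]setIid; exact: sX. Qed.

Lemma smooth_vfield_add V X Y : open V -> smooth_vfield V X ->
  smooth_vfield V Y -> smooth_vfield V (fun q => X q + Y q).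
Proof.
move=> oV sX sY W f oW sf.
by apply: smooth_on_add; [exact: openI|exact: sX|exact: sY].
Qed.

Lemma smooth_vfield_scale V f X : open V -> smooth_on V f ->
  smooth_vfield V X -> smooth_vfield V (fun q => f q *: X q).
Proof.
move=> oV sf sX W h oW sh; apply: smooth_on_mul; first exact: openI.
  exact: smooth_on_subset sf.
exact: sX.
Qed.

Lemma smooth_vfield_sum V (I : Type) (r : seq I) (F : I -> vfield M) : open V ->
  (forall i, smooth_vfield V (F i)) -> smooth_vfield V (fun q => \sum_(i <- r) F i q).
Proof.
move=> oV sF W h oW sh; have oVW := openI oV oW.
apply: smooth_on_ext (smooth_on_sum r oVW (fun i => sF i W h oW sh)) => // q _.
by rewrite tangent_sumE.
Qed.

Lemma smooth_vfield_ext V X Y : open V -> (forall q, V q -> X q = Y q) ->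
  smooth_vfield V X -> smooth_vfield V Y.
Proof.
move=> oV e sX W h oW sh; apply: smooth_on_ext (sX W h oW sh); first exact: openI.
by move=> q [Vq _]; rewrite e.
Qed.

Lemma smooth_at_near p f : smooth_at p f -> \forall q \near p, smooth_at q f.
Proof.
move=> [V [oV Vp sf]]; have : nbhs p V by exact: open_nbhs_nbhs.
by apply: filterS => q Vq; exists V.
Qed.

Section Bracket.
Variables (V : set M) (X Y : vfield M) (oV : open V).
Hypotheses (sX : smooth_vfield V X) (sY : smooth_vfield V Y).

(** Agreement near p is agreement near every q close to p, and [Z q] depends only on germs at q. *)
Lemma vfield_near (Z : vfield M) p f g : smooth_at p f -> smooth_at p g ->
  (\forall q \near p, f q = g q) -> \forall q \near p, Z q f = Z q g.
Proof.
move=> /smooth_at_near sf /smooth_at_near sg e.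
near=> q; have [_ H _ _] := tangentP (Z q); apply: H.
- by near: q.
- by near: q.
- by near: q; apply: near_join.
Unshelve. all: by end_near. Qed.

(** A composite of two fields violates the Leibniz rule by cross terms symmetric in X and Y, which
    cancel in the difference. The guarded functional is the one inside [tangent_of], whose [insubd]
    therefore does not fall back to the zero vector. *)
Lemma bracket_is_derivation p : V p ->
  is_derivation p (fun h : M -> R => if `[< smooth_at p h >]
     then X p (fun q => Y q h) - Y p (fun q => X q h) else 0 : R^o).
Proof.
move=> Vp.
have oS := @smooth_vfield_at V _ _ p oV Vp.
have key (Z T : vfield M) f g : smooth_vfield V T -> smooth_at p f -> smooth_at p g ->
    (\forall q \near p, T q f = g q) -> Z p (fun q => T q f) = Z p g.
  by move=> sT sf sg e; have [_ H _ _] := tangentP (Z p); apply: H => //; exact: oS.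
split.
- by move=> h /asboolPn /negbTE ->.
- move=> h1 h2 s1 s2 e; rewrite !asboolT //.
  by congr (_ - _); apply: key; rewrite //; try exact: oS; exact: vfield_near.
- move=> a h1 h2 s1 s2.
  have s3 : smooth_at p (fun q => a * h1 q + h2 q).
    by apply: smooth_atD => //; apply: smooth_atM => //; exact: smooth_at_cst.
  rewrite !asboolT //.
  have lin (Z T : vfield M) : smooth_vfield V T ->
      Z p (fun q => T q (fun q => a * h1 q + h2 q))
      = a * Z p (fun q => T q h1) + Z p (fun q => T q h2).
    move=> sT; rewrite -tangent_linear; try exact: oS.
    apply: key => //.
      apply: smooth_atD; last exact: oS.
      by apply: smooth_atM; [exact: smooth_at_cst|exact: oS].
    apply: filterS2 (smooth_at_near s1) (smooth_at_near s2) => q q1 q2.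
    exact: tangent_linear.
  by rewrite !lin //; ring.
- move=> h1 h2 s1 s2.
  rewrite !asboolT //; last exact: smooth_atM.
  have lin (Z T : vfield M) : smooth_vfield V T ->
      Z p (fun q => T q (fun q => h1 q * h2 q))
      = Z p (fun q => T q h1) * h2 p + T p h1 * Z p h2
        + (Z p h1 * T p h2 + h1 p * Z p (fun q => T q h2)).
    move=> sT; have t1 := oS _ _ sT s1; have t2 := oS _ _ sT s2.
    rewrite -[_ + T p h1 * _]tangentM // -[Z p h1 * _ + _]tangentM // -tangentD;
      try exact: smooth_atM.
    apply: key => //; first exact: smooth_atM.
      by apply: smooth_atD; exact: smooth_atM.
    apply: filterS2 (smooth_at_near s1) (smooth_at_near s2) => q q1 q2.
    exact: tangentM.
  by rewrite !lin //; ring.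
Unshelve. all: by end_near. Qed.

Lemma bracketE p f : V p -> smooth_at p f ->
  bracket X Y p f = X p (fun q => Y q f) - Y p (fun q => X q f).
Proof.
move=> Vp sf; rewrite /bracket /tangent_of.
have := @insubdK _ _ (tangent p) 0 (fun h : M -> R => if `[< smooth_at p h >]
     then X p (fun q => Y q h) - Y p (fun q => X q h) else 0 : R^o).
move=> /(_ _)/(congr1 (fun F => F f)) /= ->; first by rewrite asboolT.
by apply/asboolP; exact: bracket_is_derivation.
Qed.

End Bracket.
End SmoothFunctions.

(** * Tensors in components *)

Section WordAlgebra.
Variables (R : comNzRingType) (n : nat).
Implicit Types (A B : 'I_n -> 'I_n -> R) (S : seq 'I_n -> R) (s u : seq 'I_n).

(* The action of the matrix A as a derivation on covariant tensors, a tensor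
   being given by its components on words of frame indices. *)
Fixpoint tder A S s : R :=
  match s with
  | [::] => 0
  | c :: s' => \sum_e A c e * S (e :: s') + tder A (fun w => S (c :: w)) s'
  end.

Lemma eq_tder A B S S' s : (forall c e, A c e = B c e) ->
  (forall w, S w = S' w) -> tder A S s = tder B S' s.
Proof.
move=> eA; elim: s S S' => //= c s IH S S' eS; congr (_ + _).
  by apply: eq_bigr => e _; rewrite eA eS.
by apply: IH => w; exact: eS.
Qed.

Lemma tderD A S S' s : tder A (fun w => S w + S' w) s = tder A S s + tder A S' s.
Proof.
elim: s S S' => [|c s IH] S S' /=; first by rewrite addr0.
rewrite IH addrACA -big_split /=; congr (_ + _).
by apply: eq_bigr => e _; rewrite mulrDr.
Qed.

Lemma tderZ A (x : R) S s : tder A (fun w => x * S w) s = x * tder A S s.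
Proof.
elim: s S => [|c s IH] S /=; first by rewrite mulr0.
rewrite IH mulrDr mulr_sumr; congr (_ + _).
by apply: eq_bigr => e _; rewrite mulrCA.
Qed.

Lemma tder0 A s : tder A (fun=> 0) s = 0.
Proof.
by rewrite -[RHS](mul0r (tder A (fun=> 0) s)) -tderZ; apply: eq_tder => // w; rewrite mul0r.
Qed.

Lemma tder_sum A (I : Type) (r : seq I) (F : I -> seq 'I_n -> R) s :
  tder A (fun w => \sum_(i <- r) F i w) s = \sum_(i <- r) tder A (F i) s.
Proof.
elim: r => [|i r IH].
  by rewrite big_nil -[RHS](tder0 A s); apply: eq_tder => // w; rewrite big_nil.
rewrite big_cons -IH -tderD.
by apply: eq_tder => // w; rewrite big_cons.
Qed.

Lemma tderDl A B S s :
  tder (fun c e => A c e + B c e) S s = tder A S s + tder B S s.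
Proof.
elim: s S => [|c s IH] S /=; first by rewrite addr0.
rewrite IH addrACA -big_split /=; congr (_ + _).
by apply: eq_bigr => e _; rewrite mulrDl.
Qed.

Lemma tderZl A (x : R) S s : tder (fun c e => x * A c e) S s = x * tder A S s.
Proof.
elim: s S => [|c s IH] S /=; first by rewrite mulr0.
rewrite IH mulrDr mulr_sumr; congr (_ + _).
by apply: eq_bigr => e _; rewrite mulrA.
Qed.

Lemma tder0l S s : tder (fun _ _ => 0) S s = 0.
Proof.
rewrite -[RHS](mul0r (tder (fun _ _ => 0) S s)) -tderZl.
by apply: eq_tder => // c e; rewrite mul0r.
Qed.

Lemma tder_suml (I : Type) (r : seq I) (F : I -> 'I_n -> 'I_n -> R) S s :
  tder (fun c e => \sum_(i <- r) F i c e) S s = \sum_(i <- r) tder (F i) S s.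
Proof.
elim: r => [|i r IH].
  by rewrite big_nil -[RHS](tder0l S s); apply: eq_tder => // c e; rewrite big_nil.
rewrite big_cons -IH -tderDl.
by apply: eq_tder => // c e; rewrite big_cons.
Qed.

(** When A and B hit different slots the order is irrelevant, so only the commutator within a single
    slot survives: matrices act on covariant tensors as a Lie algebra. *)
Lemma tder_comm A B S s :
  tder A (tder B S) s - tder B (tder A S) s =
  tder (fun c g => \sum_d (A c d * B d g - B c d * A d g)) S s.
Proof.
elim: s S => [|c s IH] S; first by rewrite subrr.
have expand A' B' : tder A' (tder B' S) (c :: s) =
    \sum_g (\sum_d A' c d * B' d g) * S (g :: s)
    + \sum_d A' c d * tder B' (fun w => S (d :: w)) s
    + (\sum_d B' c d * tder A' (fun w => S (d :: w)) s
       + tder A' (tder B' (fun w => S (c :: w))) s).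
  have -> : tder A' (tder B' S) (c :: s)
    = \sum_d A' c d * tder B' S (d :: s) + tder A' (fun w => tder B' S (c :: w)) s by [].
  have -> : tder A' (fun w => tder B' S (c :: w)) s =
    tder A' (fun w => \sum_e B' c e * S (e :: w) + tder B' (fun w => S (c :: w)) w) s by [].
  rewrite tderD tder_sum /=; congr (_ + (_ + _)); last first.
    by apply: eq_bigr => d _; rewrite tderZ.
  under eq_bigr do rewrite mulrDr; rewrite big_split /=; congr (_ + _).
  under eq_bigr do rewrite mulr_sumr; rewrite exchange_big /=.
  apply: eq_bigr => g _; rewrite mulr_suml; apply: eq_bigr => d _.
  by rewrite mulrA.
rewrite !expand /=.
have -> : \sum_e (\sum_d (A c d * B d e - B c d * A d e)) * S (e :: s) =
   \sum_g (\sum_d A c d * B d g) * S (g :: s) - \sum_g (\sum_d B c d * A d g) * S (g :: s).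
  rewrite -sumrB; apply: eq_bigr => g _; rewrite -mulrBl; congr (_ * _).
  by rewrite -sumrB.
by rewrite -IH; ring.
Qed.

Definition delta (a b : 'I_n) : R := (a == b)%:R.

Lemma sum_deltal a (F : 'I_n -> R) : \sum_d delta a d * F d = F a.
Proof.
rewrite (bigD1 a) //= /delta eqxx mul1r big1 ?addr0 // => d da.
by rewrite eq_sym (negbTE da) mul0r.
Qed.

Lemma deltaC a b : delta a b = delta b a.
Proof. by rewrite /delta eq_sym. Qed.

(* The curvature operator of constant curvature 1, up to sign. *)
Definition rot (a b c e : 'I_n) : R := delta a c * delta b e - delta b c * delta a e.

(* The curvature form [rot] is parallel: its own derivative under a skew G
   vanishes, so G only hits S'. *)
Lemma tder_swap (G : 'I_n -> 'I_n -> R) (K : R) (S S' : seq 'I_n -> R) u a b s :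
  (forall c e, G c e = - G e c) ->
  (forall u' a b s, size u' = size u ->
    S (u' ++ a :: b :: s) - S (u' ++ b :: a :: s) =
    K * tder (rot a b) (fun w => S' (u' ++ w)) s) ->
  tder G S (u ++ a :: b :: s) - tder G S (u ++ b :: a :: s) =
  K * tder (rot a b) (fun w => tder G S' (u ++ w)) s.
Proof.
move=> Ganti; elim: u S S' => [|x u IH] S S' e; last first.
  rewrite /= opprD addrACA -sumrB.
  rewrite (IH _ (fun w => S' (x :: w))); last first.
    by move=> u' a' b' s' su; apply: (e (x :: u')); rewrite /= su.
  rewrite tderD tder_sum mulrDr mulr_sumr; congr (_ + _).
  apply: eq_bigr => d _; rewrite -mulrBr (e (d :: u)) // tderZ.
  by rewrite mulrCA.
rewrite /=.
transitivity (\sum_d G a d * (S [:: d, b & s] - S [:: b, d & s])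
   + \sum_d G b d * (S [:: a, d & s] - S [:: d, a & s])
   + (tder G (fun w => S [:: a, b & w]) s - tder G (fun w => S [:: b, a & w]) s)).
  have sumB (x y z : 'I_n -> R) :
      \sum_d x d * (y d - z d) = \sum_d x d * y d - \sum_d x d * z d.
    by rewrite -sumrB; apply: eq_bigr => d _; rewrite mulrBr.
  by rewrite !sumB; ring.
have e0 a' b' s' : S [:: a', b' & s'] - S [:: b', a' & s'] = K * tder (rot a' b') S' s'.
  exact: (e [::]).
have -> : tder G (fun w => S [:: a, b & w]) s - tder G (fun w => S [:: b, a & w]) s
    = K * tder G (tder (rot a b) S') s.
  rewrite -tderZ -[X in _ - X]mul1r -mulNr -tderZ -tderD.
  by apply: eq_tder => // w; rewrite mulN1r e0.
under eq_bigr do rewrite e0 mulrCA; rewrite -mulr_sumr.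
under [X in _ + X + _]eq_bigr do rewrite e0 mulrCA; rewrite -mulr_sumr.
rewrite -!mulrDr; congr (_ * _).
(* What is left is an identity of matrices: G applied to the indices a and b of [rot a b], plus the
   commutator of G with [rot a b], is zero. This is the invariance of [rot] under skew matrices. *)
apply/eqP; rewrite -subr_eq0 -addrA tder_comm.
have -> : \sum_i G a i * tder (rot i b) S' s = tder (fun c e => \sum_i G a i * rot i b c e) S' s.
  by rewrite tder_suml; apply: eq_bigr => i _; rewrite tderZl.
have -> : \sum_i G b i * tder (rot a i) S' s = tder (fun c e => \sum_i G b i * rot a i c e) S' s.
  by rewrite tder_suml; apply: eq_bigr => i _; rewrite tderZl.
rewrite -!tderDl -[X in _ == X](tder0l S' s); apply/eqP; apply: eq_tder => // c g.
have -> : \sum_i G a i * rot i b c g = G a c * delta b g - delta b c * G a g.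
  rewrite /rot -(sum_deltal c (fun i => G a i * delta b g))
    -(sum_deltal g (fun i => delta b c * G a i)) -sumrB.
  by apply: eq_bigr => i _; rewrite (deltaC i c) (deltaC i g); ring.
have -> : \sum_i G b i * rot a i c g = delta a c * G b g - G b c * delta a g.
  rewrite /rot -(sum_deltal g (fun i => delta a c * G b i))
    -(sum_deltal c (fun i => G b i * delta a g)) -sumrB.
  by apply: eq_bigr => i _; rewrite (deltaC i c) (deltaC i g); ring.
have -> : \sum_d (G c d * rot a b d g - rot a b c d * G d g) =
   G c a * delta b g - G c b * delta a g - (delta a c * G b g - delta b c * G a g).
  rewrite /rot -(sum_deltal a (fun i => G c i * delta b g))
    -(sum_deltal b (fun i => G c i * delta a g)).
  rewrite -(sum_deltal b (fun i => delta a c * G i g)) -(sum_deltal a (fun i => delta b c * G i g)).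
  rewrite -!sumrB.
  by apply: eq_bigr => i _; ring.
by rewrite (Ganti c a) (Ganti c b); ring.
Qed.

(* The value of the tensor with components S on m vectors with components y. *)
Fixpoint contract m (y : 'I_m -> 'I_n -> R) S : R :=
  match m return ('I_m -> 'I_n -> R) -> R with
  | 0 => fun _ => S [::]
  | m'.+1 => fun y =>
      \sum_d y ord0 d * contract (fun j => y (lift ord0 j)) (fun w => S (d :: w))
  end y.

Lemma eq_contract m (y y' : 'I_m -> 'I_n -> R) S S' :
  (forall j d, y j d = y' j d) -> (forall w, S w = S' w) ->
  contract y S = contract y' S'.
Proof.
elim: m y y' S S' => [|m IH] y y' S S' ey eS /=; first exact: eS.
apply: eq_bigr => d _; rewrite ey; congr (_ * _).
by apply: IH => // w; exact: eS.
Qed.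

Lemma contractD m (y : 'I_m -> 'I_n -> R) S S' :
  contract y (fun w => S w + S' w) = contract y S + contract y S'.
Proof.
elim: m y S S' => [|m IH] y S S' //=.
rewrite -big_split /=; apply: eq_bigr => d _; by rewrite IH mulrDr.
Qed.

Lemma contractZ m (y : 'I_m -> 'I_n -> R) x S :
  contract y (fun w => x * S w) = x * contract y S.
Proof.
elim: m y S => [|m IH] y S //=.
rewrite mulr_sumr /=; apply: eq_bigr => d _; by rewrite IH mulrCA.
Qed.

Lemma contract_sum m (y : 'I_m -> 'I_n -> R) (I : finType) (F : I -> seq 'I_n -> R) :
  contract y (fun w => \sum_i F i w) = \sum_i contract y (F i).
Proof.
elim: m y F => [|m IH] y F //=.
rewrite exchange_big; apply: eq_bigr => d _; by rewrite IH mulr_sumr.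
Qed.

Lemma contract_delta m (w : 'I_m -> 'I_n) S :
  contract (fun j => delta (w j)) S = S [seq w j | j <- enum 'I_m].
Proof.
elim: m w S => [|m IH] w S /=; first by rewrite enum_ord0.
by rewrite sum_deltal IH enum_ordSl /= -map_comp.
Qed.

End WordAlgebra.

Lemma eq_tder_size (R : comNzRingType) n (A : 'I_n -> 'I_n -> R) S S' s :
  (forall w, size w = size s -> S w = S' w) -> tder A S s = tder A S' s.
Proof.
elim: s S S' => //= c s IH S S' eS; congr (_ + _).
  by apply: eq_bigr => e _; rewrite eS.
by apply: IH => w sw; apply: eS; rewrite /= sw.
Qed.

(** Adjacent transpositions generate all rearrangements. The swap rule is asked only on
    rearrangements of [phi0], because it will be available only for good words. *)
Lemma perm_invariant (V : eqType) (Z : Type) (Q : seq V -> Z) (phi0 : seq V) :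
  (forall u x y s, perm_eq (u ++ x :: y :: s) phi0 ->
     Q (u ++ x :: y :: s) = Q (u ++ y :: x :: s)) ->
  forall phi, perm_eq phi phi0 -> Q phi = Q phi0.
Proof.
move=> swap.
have move_right u x w s : perm_eq (u ++ x :: w ++ s) phi0 ->
    Q (u ++ x :: w ++ s) = Q (u ++ w ++ x :: s).
  elim: w u => //= y w IH u pe; rewrite swap // -cat_rcons IH ?cat_rcons //.
  apply: perm_trans pe; rewrite perm_cat2l.
  by rewrite -[y :: x :: _]/([:: y] ++ [:: x] ++ (w ++ s))
    -[x :: y :: _]/([:: x] ++ [:: y] ++ (w ++ s)) perm_catCA.
have main u phi phi' : perm_eq (u ++ phi) phi0 -> perm_eq phi phi' -> Q (u ++ phi) = Q (u ++ phi').
  elim: phi u phi' => [|x phi IH] u phi' p0 pe.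
    by move: pe; rewrite perm_sym => /perm_nilP ->.
  have : x \in phi' by rewrite -(perm_mem pe) mem_head.
  move=> xin; case/path.splitPr: xin pe => w s pe.
  have pe' : perm_eq phi (w ++ s).
    by rewrite -(perm_cons x) (perm_trans pe) // -[x :: s]/([:: x] ++ s) perm_catCA.
  (* The tail is first arranged as [w ++ s] behind the longer prefix; then the head [x] is carried
     to its place. *)
  rewrite -cat_rcons (IH _ (w ++ s)) ?cat_rcons //.
  apply: move_right; apply: perm_trans p0.
  by rewrite perm_cat2l perm_cons perm_sym.
by move=> phi pe; apply: (main [::] phi phi0 pe pe).
Qed.

(** * Contractions against invariant tensors *)

Section InvariantContractions.
Variables (R : numFieldType) (n k : nat).

(* A word in these variables encodes an invariant tensor: a variable [inl x]
   is summed over all frame indices, the variables [inr y] run over the entries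
   of a permutation with its sign. *)
Notation var := ('I_k + 'I_n)%type.

(** The count 0 stands for a theta that a trace has removed or merged: [wsum] still sums over its
    variable, which contributes only a factor n. *)
Definition good_count (x : var) (m : nat) : bool :=
  match x with inl _ => (m == 0%N) || (m == 2) | inr _ => m == 1%N end.

Definition good_word (phi : seq var) := forall x, good_count x (count_mem x phi).

Definition valuation (i : {ffun 'I_k -> 'I_n}) (mu : 'S_n) (x : var) : 'I_n :=
  match x with inl x => i x | inr y => mu y end.

Definition wsum (F : (var -> 'I_n) -> R) : R :=
  \sum_i \sum_(mu : 'S_n) (-1) ^+ odd_perm mu * F (valuation i mu).

Lemma eq_wsum F G : (forall v, F v = G v) -> wsum F = wsum G.
Proof. by move=> e; apply: eq_bigr => i _; apply: eq_bigr => mu _; rewrite e. Qed.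

Lemma wsumD F G : wsum (fun v => F v + G v) = wsum F + wsum G.
Proof.
rewrite -big_split; apply: eq_bigr => i _; rewrite -big_split.
by apply: eq_bigr => mu _; rewrite mulrDr.
Qed.

Lemma wsumZ a F : wsum (fun v => a * F v) = a * wsum F.
Proof.
rewrite mulr_sumr; apply: eq_bigr => i _; rewrite mulr_sumr.
by apply: eq_bigr => mu _; rewrite mulrCA.
Qed.

Lemma wsumB F G : wsum (fun v => F v - G v) = wsum F - wsum G.
Proof.
rewrite -mulN1r -wsumZ -wsumD; apply: eq_wsum => v; by rewrite mulN1r.
Qed.

Lemma good_word_perm phi phi' : perm_eq phi phi' -> good_word phi -> good_word phi'.
Proof. by move=> /seq.permP pe g x; rewrite -pe. Qed.

Definition upd (x : 'I_k) (i : {ffun 'I_k -> 'I_n}) (a : 'I_n) : {ffun 'I_k -> 'I_n} :=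
  [ffun t => if t == x then a else i t].

(* Exchanging the value of i at x with a is an involution of the pairs (i, a). *)
Lemma sum_upd x (F : {ffun 'I_k -> 'I_n} -> R) :
  \sum_i \sum_a F (upd x i a) = n%:R * \sum_i F i.
Proof.
rewrite pair_big /=.
rewrite (reindex_inj (h := fun p => (upd x p.1 p.2, p.1 x))) /=; last first.
  apply: (can_inj (g := fun p => (upd x p.1 p.2, p.1 x))) => -[i a] /=.
  congr (_, _); last by rewrite ffunE eqxx.
  by apply/ffunP => t; rewrite !ffunE; case: eqP => [->|].
rewrite -(pair_big xpredT xpredT (fun i a => F (upd x (upd x i a) (i x)))) /=.
rewrite mulr_sumr; apply: eq_bigr => i _.
under eq_bigr => a _.
  have -> : upd x (upd x i a) (i x) = i.
    by apply/ffunP => t; rewrite !ffunE; case: eqP => [->|].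
  over.
by rewrite sumr_const card_ord mulr_natl.
Qed.

(** The delta forces the index x to equal that of z. On the right x no longer influences the summand
    but is still summed, whence the factor n. *)
Lemma wsum_contract (x : 'I_k) (z : var) (F : (var -> 'I_n) -> R) : z != inl x ->
  n%:R * wsum (fun v => delta R (v (inl x)) (v z) * F v) =
  wsum (fun v => F (fun c => v (if c == inl x then z else c))).
Proof.
move=> zx; rewrite /wsum -(sum_upd x); apply: eq_bigr => i _.
rewrite exchange_big; apply: eq_bigr => mu _.
rewrite -mulr_sumr; congr (_ * _).
have zE a : valuation (upd x i a) mu z = valuation i mu z.
  by case: z zx => [t|y] //= tx; rewrite ffunE ifN.
have xE a : valuation (upd x i a) mu (inl x) = a by rewrite /= ffunE eqxx.
transitivity (\sum_a delta R (valuation i mu z) a * F (valuation (upd x i a) mu)).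
  by apply: eq_bigr => a _; rewrite xE zE deltaC.
rewrite sum_deltal; congr (F _); apply/funext => -[t|y] /=.
  by rewrite ffunE; case: (t =P x) => [->|tx]; rewrite ?eqxx // ifN //; apply/eqP => -[].
by [].
Qed.

(** The remaining occurrence of x in [phi] replaces the occurrence of z consumed by the trace, so
    the count of z is restored and that of x drops to 0. *)
Lemma good_word_subst (x : 'I_k) (z : var) phi : z != inl x ->
  good_word (inl x :: z :: phi) ->
  good_word [seq (if c == inl x then z else c) | c <- phi].
Proof.
move=> zx g c; rewrite count_map.
have cx : count_mem (inl x) phi = 1%N.
  have := g (inl x); rewrite /= eqxx (negbTE zx) add0n.
  by case: count => [|[|m]].
have [->{c}|cz] := eqVneq c z.
  have -> : count (preim (fun c => if c == inl x then z else c) (pred1 z)) phi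
      = (count_mem z phi + count_mem (inl x) phi)%N.
    rewrite -count_predUI -[LHS]addn0; congr (_ + _)%N.
      by apply: eq_count => t /=; case: (t =P inl x) => [->|]; rewrite ?eqxx ?orbT ?orbF.
    rewrite -[LHS](count_pred0 phi); apply: eq_count => t /=.
    by apply/esym/andP => -[/eqP-> ]; rewrite (negbTE zx).
  by have := g z; rewrite /= eqxx eq_sym (negbTE zx) add0n cx addn1.
have [->{c cz}|cx'] := eqVneq c (inl x).
  rewrite (@eq_count _ _ pred0) ?count_pred0 // => t /=.
  by case: (t =P inl x) => [_|/eqP/negbTE //]; rewrite (negbTE zx).
rewrite (@eq_count _ _ (pred1 c)); last first.
  move=> t /=; case: (t =P inl x) => // ->.
  by rewrite eq_sym (negbTE cz) eq_sym (negbTE cx').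
by have := g c; rewrite /= eq_sym (negbTE cx') eq_sym (negbTE cz) !add0n.
Qed.

Hypothesis n_gt1 : (1 < n)%N.
Variables (T : seq 'I_n -> R) (K : R).
Hypothesis T_swap : forall u a b s,
  T (u ++ a :: b :: s) - T (u ++ b :: a :: s) =
  K * tder (rot R a b) (fun w => T (u ++ w)) s.

Definition wpair (phi : seq var) : R := wsum (fun v => T (map v phi)).

Lemma n_neq0 : n%:R != 0 :> R.
Proof. by rewrite pnatr_eq0 -lt0n ltnW. Qed.

Section Step.
Variable N : nat.
Hypothesis IH : forall phi, size phi = N -> good_word phi -> wpair phi = 0.

Lemma wsum_delta x z phi : size phi = N -> good_word (x :: z :: phi) ->
  wsum (fun v => delta R (v x) (v z) * T (map v phi)) = 0.
Proof.
move=> sz g; have [zx|zx] := eqVneq z x.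
  subst z; rewrite -[RHS](IH sz).
    by apply: eq_wsum => v; rewrite /delta eqxx mul1r.
  (* A letter standing twice at the front of a good word is some [inl x] and is absent from [phi]:
     its count drops from 2 to the admissible 0. *)
  move=> c; have := g c; rewrite /=; have [<-|_] := eqVneq x c; last by rewrite !add0n.
  by case: x {g} => [x|y]; rewrite /= !add1n; case: count.
have elim_var x' z' : z' != inl x' -> good_word (inl x' :: z' :: phi) ->
    wsum (fun v => delta R (v (inl x')) (v z') * T (map v phi)) = 0.
  move=> zx' g'; apply: (mulfI n_neq0); rewrite mulr0.
  rewrite (wsum_contract (fun v => T (map v phi)) zx').
  rewrite -[RHS](IH _ (good_word_subst zx' g')) ?size_map //.
  by apply: eq_wsum => v; rewrite -map_comp.
case: x g zx => [x|y] g zx; first exact: elim_var.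
case: z g zx => [x|y'] g zx.
  rewrite -[RHS](elim_var x (inr y)) //.
    by apply: eq_wsum => v; rewrite deltaC.
  apply: good_word_perm g.
  by rewrite -[inr y :: _]/([:: inr y] ++ [:: inl x] ++ phi) perm_catCA.
(* Different entries of a permutation never coincide, so the delta vanishes in every term. *)
rewrite /wsum big1 // => i _; rewrite big1 // => mu _.
rewrite /delta /= (inj_eq perm_inj) -[y == y']/(inr y == inr y' :> var) eq_sym (negbTE zx).
by rewrite mul0r mulr0.
Qed.

(** On a slot c, [rot] puts y in place of c against the delta of x and c, minus the same with x and
    y exchanged; both terms are traces covered by [wsum_delta]. The prefix [u] collects the slots
    already treated. *)
Lemma wsum_curvature x y u s : size (u ++ s) = N -> good_word (x :: y :: u ++ s) ->
  wsum (fun v => tder (rot R (v x) (v y)) (fun w => T (map v u ++ w)) (map v s)) = 0.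
Proof.
elim: s u => [|c s IHs] u sz g.
  by rewrite /wsum big1 // => i _; rewrite big1 // => mu _; rewrite mulr0.
rewrite /= wsumD.
have -> : wsum (fun v => tder (rot R (v x) (v y)) (fun w => T (map v u ++ v c :: w)) (map v s)) = 0.
  rewrite -[RHS](IHs (rcons u c)) ?cat_rcons //.
  by apply: eq_wsum => v; apply: eq_tder => // w; rewrite map_rcons cat_rcons.
have sum_rot a b c' (F : 'I_n -> R) :
    \sum_e rot R a b c' e * F e = delta R a c' * F b - delta R b c' * F a.
  rewrite -(sum_deltal b F) -(sum_deltal a F) !mulr_sumr -sumrB.
  by apply: eq_bigr => e _; rewrite /rot; ring.
rewrite addr0 (eq_wsum (G := fun v => delta R (v x) (v c) * T (map v (u ++ y :: s))
   - delta R (v y) (v c) * T (map v (u ++ x :: s)))); last first.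
  by move=> v; rewrite sum_rot !map_cat.
rewrite wsumB !wsum_delta ?subrr //; try by rewrite -sz !size_cat.
  by apply: good_word_perm g; apply/seq.permP => p; rewrite /= !count_cat /=; ring.
by apply: good_word_perm g; apply/seq.permP => p; rewrite /= !count_cat /=; ring.
Qed.

Lemma wpair_swap u x y s : size (u ++ s) = N -> good_word (u ++ x :: y :: s) ->
  wpair (u ++ x :: y :: s) = wpair (u ++ y :: x :: s).
Proof.
move=> sz g; apply/eqP; rewrite -subr_eq0 /wpair -wsumB.
rewrite (eq_wsum (G := fun v =>
    K * tder (rot R (v x) (v y)) (fun w => T (map v u ++ w)) (map v s))).
  rewrite wsumZ wsum_curvature ?mulr0 //.
  by apply: good_word_perm g; rewrite -[x :: y :: s]/([:: x; y] ++ s) perm_catCA.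
by move=> v; rewrite !map_cat /= T_swap.
Qed.

Lemma wpair_perm phi phi' : size phi = N.+2 -> good_word phi -> perm_eq phi phi' ->
  wpair phi = wpair phi'.
Proof.
move=> sz g pe; rewrite perm_sym in pe; apply/esym; move: phi' pe.
apply: perm_invariant => u x y s pe; apply: wpair_swap.
  by have := perm_size pe; rewrite sz !size_cat /= !addnS => -[].
by apply: good_word_perm g; rewrite perm_sym.
Qed.

End Step.

(** Composing [mu] with the transposition of y0 and y1 flips its sign. Each of the two letters
    occurs only once in a good word, so the rest [phi] is unaffected. *)
Lemma wpair_tperm y0 y1 phi : y0 != y1 -> good_word (inr y0 :: inr y1 :: phi) ->
  wpair (inr y1 :: inr y0 :: phi) = - wpair (inr y0 :: inr y1 :: phi).
Proof.
move=> yy g; rewrite /wpair /wsum -sumrN; apply: eq_bigr => i _.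
(* Products of permutations apply the left factor first, so this left multiplication exchanges
   arguments of [mu], not values. *)
rewrite -sumrN (reindex_inj (mulgI (tperm y0 y1))) /=; apply: eq_bigr => mu _.
rewrite odd_mul_tperm yy signr_addb expr1 mulN1r mulNr; congr (- (_ * T (_ :: _ :: _))).
- by rewrite permM tpermR.
- by rewrite permM tpermL.
- apply/eq_in_map => -[t|y] //= yp; rewrite permM tpermD //.
    apply/eqP => e; move: yp; rewrite -e -has_pred1 has_count => yp.
    by have := g (inr y0); rewrite /= eqxx add1n eqSS addn_eq0 (gtn_eqF yp) andbF.
  apply/eqP => e; move: yp; rewrite -e -has_pred1 has_count => yp.
  by have := g (inr y1); rewrite /= eqxx addnCA add1n eqSS addn_eq0 (gtn_eqF yp) andbF.
Qed.

(** Strong induction without a base case: a good word contains every letter [inr y], hence at least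
    two letters since n > 1, and the induction hypothesis is used at length two less. *)
Theorem wpair0 phi : good_word phi -> wpair phi = 0.
Proof.
have [m sz] := ubnP (size phi); elim: m phi sz => // m IHm phi sz g.
pose y0 : 'I_n := Ordinal (ltnW n_gt1); pose y1 : 'I_n := Ordinal n_gt1.
have yy : y0 != y1 by [].
have mem_inr y : inr y \in phi.
  by rewrite -has_pred1 has_count; have := g (inr y) => /= /eqP ->.
have in0 := mem_inr y0.
have p0 := perm_to_rem in0.
have in1 : inr y1 \in rem (inr y0) phi.
  by have := mem_inr y1; rewrite (perm_mem p0) inE => /orP[/eqP[]|].
have p1 := perm_to_rem in1.
set phi' := rem _ (rem _ _) in p1.
have pe : perm_eq phi (inr y0 :: inr y1 :: phi') by rewrite (perm_trans p0) // perm_cons.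
have szE : size phi = (size phi').+2 by rewrite (perm_size pe).
have IH phi0 : size phi0 = size phi' -> good_word phi0 -> wpair phi0 = 0.
  by move=> s0; apply: IHm; rewrite s0; move: sz; rewrite szE !ltnS => /ltnW.
have g1 := good_word_perm pe g.
rewrite (wpair_perm IH szE g pe).
have : wpair (inr y0 :: inr y1 :: phi') = wpair (inr y1 :: inr y0 :: phi').
  by apply: (wpair_swap (u := [::]) IH).
rewrite (wpair_tperm yy g1) => /eqP; rewrite -addr_eq0 -mulr2n mulrn_eq0 /=.
by move=> /eqP.
Qed.

End InvariantContractions.

(** * Curvature *)

Section Polarization.
Variables (R : realFieldType) (V : zmodType) (Q : V -> V -> V -> V -> R).
Hypotheses (QD1 : forall x x' y z w, Q (x + x') y z w = Q x y z w + Q x' y z w)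
  (QD3 : forall x y z z' w, Q x y (z + z') w = Q x y z w + Q x y z' w)
  (Q12 : forall x y z w, Q x y z w = - Q y x z w)
  (Q34 : forall x y z w, Q x y z w = - Q x y w z)
  (Qbianchi : forall x y z w, Q x y z w + Q y z x w + Q z x y w = 0)
  (Qsec : forall x y, Q x y y x = 0).

(** The classical fact that a tensor with the symmetries of a curvature tensor is determined by its
    sectional curvatures. *)
Lemma curvature_polarization x y z w : Q x y z w = 0.
Proof.
(* Pair symmetry, from the Bianchi identities of the four cyclic rotations of the arguments. *)
have pair a b c d : Q a b c d = Q c d a b.
  have := Qbianchi a b c d; have := Qbianchi b c d a.
  have := Qbianchi c d a b; have := Qbianchi d a b c.
  have := Q34 b c d a; have := Q12 c a b d; have := Q34 a c b d.
  have := Q34 c d b a; have := Q12 d b c a; have := Q34 b d c a.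
  have := Q34 d a c b; have := Q34 a b d c.
  lra.
have sym a b d : Q a b b d = 0.
  have := Qsec (a + d) b; rewrite QD1 (Q34 a) (Q34 d) !QD3.
  have := Qsec a b; have := Qsec d b; have := pair a b b d.
  have := Q12 b d a b; have := Q34 d b a b; have := Q34 a b d b.
  have := Q34 a b a b; have := Q34 d b d b.
  lra.
(* A second polarization makes Q skew in the middle pair as well, hence totally skew, and the
   Bianchi identity becomes 3 Q = 0. *)
have alt a b c d : Q a b c d = - Q a c b d.
  have := sym a (b + c) d; rewrite (Q12 a) QD1 !QD3.
  have := sym a b d; have := sym a c d.
  have := Q12 b a b d; have := Q12 b a c d; have := Q12 c a b d; have := Q12 c a c d.
  lra.
have := Qbianchi x y z w; have := alt x y z w; have := Q12 x z y w.
have := alt y z x w; have := Q12 y x z w.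
lra.
Qed.

End Polarization.

Section LeviCivita.
Variables (R : realType) (n : nat) (M : riemannianManifold R n).
Variables (nabla : connection M) (U : set M).
Hypotheses (nabla_LC : levi_civita nabla) (oU : open U).
Implicit Types (X Y Z W : vfield M).

Lemma smooth_covd X Y : smooth_vfield U X -> smooth_vfield U Y ->
  smooth_vfield U (covd nabla X Y).
Proof. by have [[H _ _ _ _] _ _] := nabla_LC; exact: H. Qed.

Lemma nabla_linear Y p a (u v : tangent p) : smooth_vfield U Y -> U p ->
  nabla (a *: u + v) Y = a *: nabla u Y + nabla v Y.
Proof. by have [[_ H _ _ _] _ _] := nabla_LC; exact: H. Qed.

Lemma nabla_zero Y p : smooth_vfield U Y -> U p -> nabla (0 : tangent p) Y = 0.
Proof.
move=> sY Up; have := nabla_linear (-1) 0 0 sY Up.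
by rewrite scaler0 addr0 scaleN1r addNr.
Qed.

Lemma nablaDl Y p (u v : tangent p) : smooth_vfield U Y -> U p ->
  nabla (u + v) Y = nabla u Y + nabla v Y.
Proof. by move=> sY Up; have := nabla_linear 1 u v sY Up; rewrite !scale1r. Qed.

Lemma nablaZl Y p a (u : tangent p) : smooth_vfield U Y -> U p ->
  nabla (a *: u) Y = a *: nabla u Y.
Proof.
by move=> sY Up; have := nabla_linear a u 0 sY Up; rewrite !addr0 nabla_zero // addr0.
Qed.

Lemma nabla_suml Y p (I : Type) (r : seq I) (v : I -> tangent p) :
  smooth_vfield U Y -> U p ->
  nabla (\sum_(i <- r) v i) Y = \sum_(i <- r) nabla (v i) Y.
Proof.
move=> sY Up; elim: r => [|i r IH]; first by rewrite !big_nil nabla_zero.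
by rewrite !big_cons nablaDl // IH.
Qed.

Lemma nablaDr Y Z p (v : tangent p) : smooth_vfield U Y -> smooth_vfield U Z -> U p ->
  nabla v (fun q => Y q + Z q) = nabla v Y + nabla v Z.
Proof. by have [[_ _ H _ _] _ _] := nabla_LC; exact: H. Qed.

Lemma nablaZr (a : R) Y p (v : tangent p) : smooth_vfield U Y -> U p ->
  nabla v (fun q => a *: Y q) = a *: nabla v Y.
Proof.
move=> sY Up; have [[_ _ _ H _] _ _] := nabla_LC.
by rewrite (H U (fun=> a)) ?tangent_cst ?scale0r ?add0r //; exact: smooth_on_cst.
Qed.

Lemma nabla_ext Y Z p (v : tangent p) : smooth_vfield U Y -> U p ->
  (forall q, U q -> Y q = Z q) -> nabla v Y = nabla v Z.
Proof.
move=> sY Up e; have [[_ _ _ _ H] _ _] := nabla_LC.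
by apply: (H U) => //; apply: smooth_vfield_ext sY.
Qed.

Lemma nabla_torsion X Y p : smooth_vfield U X -> smooth_vfield U Y -> U p ->
  covd nabla X Y p - covd nabla Y X p = bracket X Y p.
Proof. by have [_ H _] := nabla_LC; exact: H. Qed.

Lemma nabla_metric Y Z p (v : tangent p) : smooth_vfield U Y -> smooth_vfield U Z -> U p ->
  v (fun q => metric (Y q) (Z q)) = metric (nabla v Y) (Z p) + metric (Y p) (nabla v Z).
Proof. by have [_ _ H] := nabla_LC; exact: H. Qed.

(** Torsion-freeness writes the bracket as a difference of covariant derivatives, whose smoothness
    is part of the definition of a connection. *)
Lemma smooth_bracket X Y : smooth_vfield U X -> smooth_vfield U Y ->
  smooth_vfield U (bracket X Y).
Proof.
move=> sX sY.
have s1 := smooth_vfield_add oU (smooth_covd sX sY)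
  (smooth_vfield_scale oU (smooth_on_cst U (-1)) (smooth_covd sY sX)).
apply: smooth_vfield_ext oU _ s1 => q Uq.
by rewrite scaleN1r nabla_torsion.
Qed.

Section MetricLinear.
Variable p : M.
Implicit Types (u v w : tangent p).

Lemma metric0l w : metric 0 w = 0.
Proof.
have := metricP (-1) 0 0 w; rewrite scaler0 addr0 mulN1r => ->.
by rewrite addNr.
Qed.

Lemma metricDl u v w : metric (u + v) w = metric u w + metric v w.
Proof. by have := metricP 1 u v w; rewrite scale1r mul1r. Qed.

Lemma metricZl a u w : metric (a *: u) w = a * metric u w.
Proof. by have := metricP a u 0 w; rewrite addr0 metric0l addr0. Qed.

Lemma metricNl u w : metric (- u) w = - metric u w.
Proof. by rewrite -scaleN1r metricZl mulN1r. Qed.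

Lemma metric_suml (I : Type) (r : seq I) (v : I -> tangent p) w :
  metric (\sum_(i <- r) v i) w = \sum_(i <- r) metric (v i) w.
Proof.
elim: r => [|i r IH]; first by rewrite !big_nil metric0l.
by rewrite !big_cons metricDl IH.
Qed.

End MetricLinear.

Lemma curvatureC X Y Z p : smooth_vfield U X -> smooth_vfield U Y ->
  smooth_vfield U Z -> U p ->
  curvature nabla X Y Z p = - curvature nabla Y X Z p.
Proof.
move=> sX sY sZ Up; rewrite /curvature.
have -> : covd nabla (bracket X Y) Z p = - covd nabla (bracket Y X) Z p.
  rewrite /covd -nabla_torsion // -(nabla_torsion sY) // -opprB -scaleN1r.
  by rewrite nablaZl // scaleN1r.
by rewrite !opprB opprK addrC.
Qed.

Lemma curvatureDl X X' Y Z p (a : R) : smooth_vfield U X -> smooth_vfield U X' ->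
  smooth_vfield U Y -> smooth_vfield U Z -> U p ->
  curvature nabla (fun q => a *: X q + X' q) Y Z p =
  a *: curvature nabla X Y Z p + curvature nabla X' Y Z p.
Proof.
move=> sX sX' sY sZ Up; rewrite /curvature.
have saX : smooth_vfield U (fun q => a *: X q).
  by apply: smooth_vfield_scale => //; exact: smooth_on_cst.
have sXX := smooth_vfield_add oU saX sX'.
have lin W q : smooth_vfield U W -> U q ->
    covd nabla (fun q => a *: X q + X' q) W q = a *: covd nabla X W q + covd nabla X' W q.
  by move=> sW Uq; exact: nabla_linear.
have lin2 W : smooth_vfield U W ->
    covd nabla Y (covd nabla (fun q => a *: X q + X' q) W) p =
    a *: covd nabla Y (covd nabla X W) p + covd nabla Y (covd nabla X' W) p.
  move=> sW; rewrite {1}/covd.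
  rewrite (nabla_ext (Z := fun q => a *: covd nabla X W q + covd nabla X' W q)) //.
  - rewrite nablaDr ?nablaZr //; try exact: smooth_covd.
    by apply: smooth_vfield_scale; [|exact: smooth_on_cst|exact: smooth_covd].
  - exact: smooth_covd.
  - by move=> q; exact: lin.
have linb : covd nabla (bracket (fun q => a *: X q + X' q) Y) Z p =
   a *: covd nabla (bracket X Y) Z p + covd nabla (bracket X' Y) Z p.
  rewrite /covd -nabla_linear // -!nabla_torsion // lin //.
  rewrite /covd nablaDr ?nablaZr // -/(covd nabla X Y p).
  by rewrite scalerBr opprD addrACA.
rewrite lin // ?lin2 // ?linb; last exact: smooth_covd.
apply: tangent_eq => f _; rewrite !(tangent_addE, tangent_oppE, tangent_scaleE).
by ring.
Qed.

Lemma curvatureDr X Y Z Z' p (a : R) : smooth_vfield U X -> smooth_vfield U Y ->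
  smooth_vfield U Z -> smooth_vfield U Z' -> U p ->
  curvature nabla X Y (fun q => a *: Z q + Z' q) p =
  a *: curvature nabla X Y Z p + curvature nabla X Y Z' p.
Proof.
move=> sX sY sZ sZ' Up; rewrite /curvature.
have saZ : smooth_vfield U (fun q => a *: Z q).
  by apply: smooth_vfield_scale => //; exact: smooth_on_cst.
have sZZ := smooth_vfield_add oU saZ sZ'.
have lin W q : smooth_vfield U W -> U q ->
    covd nabla W (fun q => a *: Z q + Z' q) q = a *: covd nabla W Z q + covd nabla W Z' q.
  by move=> sW Uq; rewrite /covd nablaDr // nablaZr.
have lin2 W W' : smooth_vfield U W -> smooth_vfield U W' ->
    covd nabla W' (covd nabla W (fun q => a *: Z q + Z' q)) p =
    a *: covd nabla W' (covd nabla W Z) p + covd nabla W' (covd nabla W Z') p.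
  move=> sW sW'; rewrite {1}/covd.
  rewrite (nabla_ext (Z := fun q => a *: covd nabla W Z q + covd nabla W Z' q)) //.
  - rewrite nablaDr ?nablaZr //; try exact: smooth_covd.
    by apply: smooth_vfield_scale; [|exact: smooth_on_cst|exact: smooth_covd].
  - exact: smooth_covd.
  - by move=> q; exact: lin.
rewrite !lin2 // lin //; last exact: smooth_bracket.
apply: tangent_eq => f _; rewrite !(tangent_addE, tangent_oppE, tangent_scaleE).
by ring.
Qed.

(** The bracket formula applied to the function <Z, W>: after expansion by metric compatibility, the
    mixed terms such as <nabla_X Z, nabla_Y W> cancel in the antisymmetrization. *)
Lemma curvature_skew X Y Z W p : smooth_vfield U X -> smooth_vfield U Y ->
  smooth_vfield U Z -> smooth_vfield U W -> U p ->
  metric (curvature nabla X Y Z p) (W p) = - metric (curvature nabla X Y W p) (Z p).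
Proof.
move=> sX sY sZ sW Up; rewrite /curvature !(metricDl, metricNl).
have sm Z1 Z2 : smooth_vfield U Z1 -> smooth_vfield U Z2 ->
    smooth_on U (fun q => metric (Z1 q) (Z2 q)).
  by move=> s1 s2; exact: metric_smooth.
have sc := smooth_covd.
have second X' Y' : smooth_vfield U X' -> smooth_vfield U Y' ->
    X' p (fun q => Y' q (fun q => metric (Z q) (W q))) =
    metric (covd nabla X' (covd nabla Y' Z) p) (W p)
    + metric (covd nabla Y' Z p) (covd nabla X' W p)
    + (metric (covd nabla X' Z p) (covd nabla Y' W p)
       + metric (Z p) (covd nabla X' (covd nabla Y' W) p)).
  move=> sX' sY'; rewrite (tangent_local _ oU Up
    (g := fun q => metric (covd nabla Y' Z q) (W q) + metric (Z q) (covd nabla Y' W q))).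
  - rewrite tangentD; try by apply: (smooth_on_at oU Up); apply: sm => //; exact: sc.
    by rewrite !nabla_metric //; exact: sc.
  - by apply: smooth_vfieldE => //; exact: sm.
  - by move=> q Uq; exact: nabla_metric.
have := bracketE oU sX sY Up (smooth_on_at oU Up (sm _ _ sZ sW)).
rewrite !second // nabla_metric // !(metricC (Z p)) -!/(covd nabla (bracket X Y) _ p).
lra.
Qed.

(** Torsion-freeness turns the cyclic sum into the Jacobi identity for vector fields, which is
    checked on functions. *)
Lemma curvature_bianchi X Y Z p : smooth_vfield U X -> smooth_vfield U Y ->
  smooth_vfield U Z -> U p ->
  curvature nabla X Y Z p + curvature nabla Y Z X p + curvature nabla Z X Y p = 0.
Proof.
move=> sX sY sZ Up.
have sc := smooth_covd; have sb := smooth_bracket.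
have tors X' Y' Z' : smooth_vfield U X' -> smooth_vfield U Y' -> smooth_vfield U Z' ->
    covd nabla X' (covd nabla Y' Z') p - covd nabla X' (covd nabla Z' Y') p
    - covd nabla (bracket Y' Z') X' p = bracket X' (bracket Y' Z') p.
  move=> sX' sY' sZ'; rewrite -nabla_torsion //; last exact: sb.
  congr (_ - _); rewrite [RHS]/covd.
  rewrite (nabla_ext (Z := fun q => covd nabla Y' Z' q + (-1) *: covd nabla Z' Y' q)).
  - rewrite nablaDr ?nablaZr ?scaleN1r //; try exact: sc.
    by apply: smooth_vfield_scale; [|exact: smooth_on_cst|exact: sc].
  - exact: sb.
  - by [].
  - by move=> q Uq; rewrite scaleN1r nabla_torsion.
have jacobi : bracket X (bracket Y Z) p + bracket Y (bracket Z X) p + bracket Z (bracket X Y) p = 0.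
  apply: tangent_eq => f sf; rewrite !tangent_addE.
  have sat W : smooth_vfield U W -> smooth_at p (fun q => W q f).
    by move=> sW; exact: (smooth_vfield_at oU Up sW sf).
  have sat2 W T : smooth_vfield U W -> smooth_vfield U T ->
      smooth_at p (fun q => W q (fun r => T r f)).
    by move=> sW sT; apply: (smooth_vfield_at oU Up sW); exact: sat.
  have outer X' Y' Z' : smooth_vfield U X' -> smooth_vfield U Y' -> smooth_vfield U Z' ->
      bracket X' (bracket Y' Z') p f =
      X' p (fun q => Y' q (fun r => Z' r f)) - X' p (fun q => Z' q (fun r => Y' r f))
      - (Y' p (fun q => Z' q (fun r => X' r f)) - Z' p (fun q => Y' q (fun r => X' r f))).
    move=> sX' sY' sZ'; rewrite (bracketE oU) //; last exact: sb.
    rewrite (bracketE oU sY' sZ' Up (sat _ sX')) -tangentB; try exact: sat2.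
    congr (_ - _); have [V [oV Vp sfV]] := sf.
    have oW := openI oU oV.
    apply: (tangent_local _ oW); first by split.
      by apply: smooth_on_subset (sb _ _ sY' sZ' _ _ oV sfV).
    move=> q [Uq Vq]; apply: (bracketE oU) => //; exact: smooth_on_at oV Vq sfV.
  rewrite !outer //.
  by rewrite -[RHS]/0; ring.
rewrite -[RHS]jacobi -!tors // /curvature.
move: (covd nabla (bracket X Y) Z p) (covd nabla (bracket Y Z) X p) (covd nabla (bracket Z X) Y p).
move: (covd nabla X (covd nabla Y Z) p) (covd nabla Y (covd nabla X Z) p)
  (covd nabla Y (covd nabla Z X) p) (covd nabla Z (covd nabla Y X) p)
  (covd nabla Z (covd nabla X Y) p) (covd nabla X (covd nabla Z Y) p).
move=> a b c d e g x y z; apply/eqP; rewrite -subr_eq0; apply/eqP.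
apply: tangent_eq => f _.
rewrite !(tangent_addE, tangent_oppE).
by rewrite -[RHS]/0; ring.
Qed.

End LeviCivita.

(** * Covariant derivatives in a frame *)

Section Frame.
Variables (R : realType) (n : nat) (M : riemannianManifold R n).
Variables (nabla : connection M) (U : set M) (X : 'I_n -> vfield M) (K : R).
Hypotheses (nabla_LC : levi_civita nabla) (oU : open U)
  (X_frame : orthonormal_frame U X)
  (M_curvature : constant_sectional_curvature nabla K) (K_neq0 : K <> 0).

Let sX i : smooth_vfield U (X i).
Proof. by have [H _ _] := X_frame; exact: H. Qed.

Let XX p i j : U p -> metric (X i p) (X j p) = delta R i j.
Proof. by have [_ H _] := X_frame; exact: H. Qed.

Let sc := smooth_covd nabla_LC oU.

Lemma frame_expand p (v : tangent p) : U p -> v = \sum_i metric v (X i p) *: X i p.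
Proof.
move=> Up; have [_ _ /(_ p v Up) [a va]] := X_frame.
rewrite {1}va; apply: eq_bigr => i _; congr (_ *: _).
rewrite va metric_suml (bigD1 i) //= metricZl XX // /delta eqxx mulr1.
rewrite big1 ?addr0 // => j ji.
by rewrite metricZl XX // /delta (negbTE ji) mulr0.
Qed.

Lemma metric_expand p (v w : tangent p) : U p ->
  metric v w = \sum_i metric v (X i p) * metric w (X i p).
Proof.
move=> Up; rewrite {1}(frame_expand v Up) metric_suml.
by apply: eq_bigr => i _; rewrite metricZl (metricC _ w).
Qed.

(** With constant coefficients the curvature only has to be linear over the reals in its field
    arguments, while every tangent vector over U is still the value of such a field. *)
Definition frame_comb (u : 'rV[R]_n) : vfield M := fun q => \sum_i u 0 i *: X i q.

Lemma smooth_frame_comb u : smooth_vfield U (frame_comb u).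
Proof.
apply: smooth_vfield_sum => // i; apply: smooth_vfield_scale => //.
exact: smooth_on_cst.
Qed.

Lemma frame_comb_linear a u v :
  frame_comb (a *: u + v) = fun q => a *: frame_comb u q + frame_comb v q.
Proof.
apply: functional_extensionality_dep => q; rewrite /frame_comb scaler_sumr -big_split.
by apply: eq_bigr => i _; rewrite !mxE scalerDl scalerA.
Qed.

Lemma frame_comb_delta a : frame_comb (delta_mx 0 a) = X a.
Proof.
apply: functional_extensionality_dep => q; rewrite /frame_comb (bigD1 a) //= mxE !eqxx scale1r.
rewrite big1 ?addr0 // => i ia; by rewrite mxE (negbTE ia) andbF scale0r.
Qed.

Lemma frame_comb_inj p u : U p -> frame_comb u p = 0 -> u = 0.
Proof.
move=> Up e; apply/rowP => i; rewrite mxE -(metric0l (X i p)) -e.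
rewrite /frame_comb metric_suml (bigD1 i) //= metricZl XX // /delta eqxx mulr1.
rewrite big1 ?addr0 // => j ji.
by rewrite metricZl XX // /delta (negbTE ji) mulr0.
Qed.

(** The difference [Q] between the curvature and the constant curvature model has the symmetries of
    a curvature tensor and zero sectional curvature, so polarization applies. *)
Lemma frame_curvature p a b c e : U p ->
  metric (curvature nabla (X a) (X b) (X c) p) (X e p) = - (K * rot R a b c e).
Proof.
move=> Up.
pose g u v := metric (frame_comb u p) (frame_comb v p).
pose Q u v w z := metric (curvature nabla (frame_comb u) (frame_comb v) (frame_comb w) p)
  (frame_comb z p) - K * (g v w * g u z - g u w * g v z).
have sF := smooth_frame_comb.
have gC u v : g u v = g v u by exact: metricC.
have gL t u v w : g (t *: u + v) w = t * g u w + g v w.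
  by rewrite /g frame_comb_linear metricP.
have QL1 t u u' v w z : Q (t *: u + u') v w z = t * Q u v w z + Q u' v w z.
  by rewrite /Q frame_comb_linear (curvatureDl nabla_LC oU) // metricP -/(frame_comb _) !gL; ring.
have QL3 t u v w w' z : Q u v (t *: w + w') z = t * Q u v w z + Q u v w' z.
  rewrite /Q frame_comb_linear (curvatureDr nabla_LC oU) // metricP.
  by rewrite !(gC _ (t *: w + w')) !gL !(gC w) !(gC w'); ring.
have Q12 u v w z : Q u v w z = - Q v u w z.
  by rewrite /Q (curvatureC nabla_LC oU) // metricNl; ring.
have Q34 u v w z : Q u v w z = - Q u v z w.
  by rewrite /Q (curvature_skew nabla_LC oU) //; ring.
have Qb u v w z : Q u v w z + Q v w u z + Q w u v z = 0.
  have := metric0l (frame_comb z p).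
  rewrite -(curvature_bianchi nabla_LC oU (sF u) (sF v) (sF w) Up) 2!metricDl => B.
  by rewrite /Q (gC v u) (gC w u) (gC w v); move: B; lra.
have QZ t u v w z : Q (t *: u) v w z = t * Q u v w z.
  have Q0 : Q 0 v w z = 0.
    by have := QL1 (-1) 0 0 v w z; rewrite scaler0 addr0; lra.
  by rewrite -[t *: u]addr0 QL1 Q0 addr0.
have Qdiag t u w z : Q (t *: u) u w z = 0.
  have Q0 : Q u u w z = 0 by have := Q12 u u w z; lra.
  by rewrite QZ Q0 mulr0.
have Qsec u v : Q u v v u = 0.
  have [indep|dep] := pselect (forall t s : R,
      t *: frame_comb u p + s *: frame_comb v p = 0 -> t = 0 /\ s = 0).
    have := M_curvature oU (sF u) (sF v) Up indep; rewrite /sectional_curvature.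
    set num := metric (curvature _ _ _ _ _) _; set den := _ - _ => e'.
    (* A vanishing denominator would give the curvature the value 0, not K. *)
    have den0 : den != 0.
      by apply/eqP => d0; apply: K_neq0; rewrite -e' d0 invr0 mulr0.
    (* The Gram determinant is exactly the factor of K in [Q u v v u]. *)
    have dE : g v v * g u u - g u v * g v u = den.
      by rewrite /den /g (metricC (frame_comb v p) (frame_comb u p)); ring.
    by rewrite /Q -/num -e' dE divfK ?subrr.
  (* At p the frame is linearly independent, so dependence of the two fields there is dependence of
     the coefficient vectors; Q, skew in its first two arguments, vanishes on proportional ones. *)
  have [t [s [e' ts]]] : exists t s : R,
      t *: u + s *: v = 0 /\ ~ (t = 0 /\ s = 0).
    apply: contrapT => no; apply: dep => t s e'.
    apply: contrapT => ts; apply: no; exists t, s; split=> //.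
    apply: (frame_comb_inj Up); rewrite frame_comb_linear.
    by rewrite -[s *: v]addr0 frame_comb_linear -[RHS]e' /frame_comb
      [X in _ + (_ + X)]big1 ?addr0 // => i _; rewrite mxE scale0r.
  have [t0|t0] := eqVneq t 0.
    have s0 : s != 0 by apply/eqP => s0; apply: ts.
    have v0 : v = 0 by apply/eqP; move/eqP: e'; rewrite t0 scale0r add0r scaler_eq0 (negbTE s0).
    by rewrite Q12 v0 -(scale0r u) Qdiag oppr0.
  have -> : u = (- (t^-1 * s)) *: v.
    apply: (scalerI t0); rewrite scalerA mulrN mulrA mulfV // mul1r scaleNr.
    by apply/eqP; rewrite -addr_eq0 e'.
  exact: Qdiag.
have QD1 u u' v w z : Q (u + u') v w z = Q u v w z + Q u' v w z.
  by rewrite -[u]scale1r QL1 mul1r scale1r.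
have QD3 u v w w' z : Q u v (w + w') z = Q u v w z + Q u v w' z.
  by rewrite -[w]scale1r QL3 mul1r scale1r.
have := curvature_polarization QD1 QD3 Q12 Q34 Qb Qsec
  (delta_mx 0 a) (delta_mx 0 b) (delta_mx 0 c) (delta_mx 0 e).
rewrite /Q /g !frame_comb_delta !XX // /rot => /eqP; rewrite subr_eq0 => /eqP ->.
by ring.
Qed.

(** The connection form of the frame along v, as a matrix that can act through [tder]. *)
Definition gamma q (v : tangent q) (c e : 'I_n) : R := metric (nabla v (X c)) (X e q).

Lemma gammaN q (v : tangent q) c e : U q -> gamma v c e = - gamma v e c.
Proof.
move=> Uq; have := nabla_metric nabla_LC oU v (sX c) (sX e) Uq.
rewrite (tangent_local v oU Uq (g := fun=> delta R c e)).
- by rewrite tangent_cst /gamma (metricC (X c q)) => /esym/eqP; rewrite addr_eq0 => /eqP.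
- exact: metric_smooth.
- by move=> r Ur; exact: XX.
Qed.

Lemma gamma_sum q (v : tangent q) c e : U q ->
  gamma v c e = \sum_a metric v (X a q) * gamma (X a q) c e.
Proof.
move=> Uq; rewrite {1}(frame_expand v Uq) /gamma (nabla_suml nabla_LC oU) // metric_suml.
by apply: eq_bigr => a _; rewrite (nablaZl nabla_LC oU) // metricZl.
Qed.

Lemma smooth_gamma a c e : smooth_on U (fun q => gamma (X a q) c e).
Proof. by apply: metric_smooth => //; apply: sc. Qed.

Lemma frame_torsion p f a b : U p -> smooth_at p f ->
  X a p (fun q => X b q f) - X b p (fun q => X a q f) =
  \sum_d (gamma (X a p) b d - gamma (X b p) a d) * X d p f.
Proof.
move=> Up sf; rewrite -(bracketE oU (sX a) (sX b) Up sf) -(nabla_torsion nabla_LC oU) //.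
rewrite (frame_expand (_ - _) Up) tangent_sumE; apply: eq_bigr => d _.
by rewrite tangent_scaleE metricDl metricNl.
Qed.

(** Cartan's second structure equation. The last sum is the connection form on the bracket of [X a]
    and [X b], expanded by torsion-freeness. *)
Lemma frame_curvature_gamma p a b c e : U p ->
  metric (curvature nabla (X a) (X b) (X c) p) (X e p) =
  X a p (fun q => gamma (X b q) c e) - X b p (fun q => gamma (X a q) c e)
  - \sum_d (gamma (X a p) c d * gamma (X b p) d e - gamma (X b p) c d * gamma (X a p) d e)
  - \sum_d (gamma (X a p) b d - gamma (X b p) a d) * gamma (X d p) c e.
Proof.
move=> Up.
have second a' b' : metric (covd nabla (X a') (covd nabla (X b') (X c)) p) (X e p) =
    X a' p (fun q => gamma (X b' q) c e) + \sum_d gamma (X b' p) c d * gamma (X a' p) d e.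
  rewrite /gamma (nabla_metric nabla_LC oU) //; last exact: sc.
  rewrite -addrA -[LHS]addr0; congr (_ + _).
  rewrite (metric_expand _ (nabla (X a' p) (X e)) Up) -big_split big1 // => d _ /=.
  by have := gammaN (X a' p) e d Up; rewrite /gamma /covd => ->; rewrite mulrN addNr.
rewrite /curvature !metricDl !metricNl !second sumrB.
have -> : metric (covd nabla (bracket (X a) (X b)) (X c) p) (X e p) =
    \sum_d (gamma (X a p) b d - gamma (X b p) a d) * gamma (X d p) c e.
  rewrite -[LHS]/(gamma (bracket (X a) (X b) p) c e) gamma_sum //.
  apply: eq_bigr => d _; rewrite -(nabla_torsion nabla_LC oU) //.
  by rewrite metricDl metricNl.
by ring.
Qed.

Lemma smooth_tder (A : 'I_n -> 'I_n -> M -> R) (S : seq 'I_n -> M -> R) s :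
  (forall c e, smooth_on U (A c e)) -> (forall w, smooth_on U (S w)) ->
  smooth_on U (fun q => tder (fun c e => A c e q) (fun w => S w q) s).
Proof.
move=> sA; elim: s S => [|c s IH] S sS /=; first exact: smooth_on_cst.
apply: smooth_on_add => //; last by apply: (IH (fun w => S (c :: w))) => w.
by apply: smooth_on_sum => // e; apply: smooth_on_mul.
Qed.

Lemma tangent_tder p (v : tangent p) (A : 'I_n -> 'I_n -> M -> R) (S : seq 'I_n -> M -> R) s :
  U p -> (forall c e, smooth_on U (A c e)) -> (forall w, smooth_on U (S w)) ->
  v (fun q => tder (fun c e => A c e q) (fun w => S w q) s) =
  tder (fun c e => v (A c e)) (fun w => S w p) s + tder (fun c e => A c e p) (fun w => v (S w)) s.
Proof.
move=> Up sA; elim: s S => [|c s IH] S sS /=; first by rewrite tangent_cst addr0.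
have at_ f : smooth_on U f -> smooth_at p f by exact: smooth_on_at.
rewrite tangentD; first last.
- by apply: at_; apply: (smooth_tder s sA (S := fun w => S (c :: w))) => w.
- by apply: at_; apply: smooth_on_sum => // e; apply: smooth_on_mul.
rewrite (IH (fun w => S (c :: w))) // addrACA -big_split; congr (_ + _).
rewrite (tangent_sum _ _ oU Up); last by move=> e; apply: smooth_on_mul.
by apply: eq_bigr => e _; rewrite tangentM //; apply: at_.
Qed.

(** Components of the covariant derivative, new index first. Words of all lengths are treated at
    once; [tder] preserves length, so different orders do not mix. *)
Definition cov_deriv (S : seq 'I_n -> M -> R) (s : seq 'I_n) : M -> R := fun q =>
  match s with
  | [::] => 0
  | a :: s' => X a q (S s') - tder (gamma (X a q)) (fun w => S w q) s'
  end.

Lemma smooth_cov_deriv S : (forall w, smooth_on U (S w)) ->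
  forall s, smooth_on U (cov_deriv S s).
Proof.
move=> sS [|a s]; first exact: smooth_on_cst.
apply: smooth_onB => //; first by apply: smooth_vfieldE.
by apply: (smooth_tder s (A := fun c e q => gamma (X a q) c e)) => // c e; exact: smooth_gamma.
Qed.

(** The antisymmetrized second derivatives of S leave a bracket, which torsion-freeness cancels; the
    remaining first-order terms are symmetric in a and b; the terms without derivatives of S
    assemble into the structure equation. *)
Lemma ricci_identity S a b s p : U p -> (forall w, smooth_on U (S w)) ->
  cov_deriv (cov_deriv S) (a :: b :: s) p - cov_deriv (cov_deriv S) (b :: a :: s) p =
  K * tder (rot R a b) (fun w => S w p) s.
Proof.
move=> Up sS.
have at_ f : smooth_on U f -> smooth_at p f by exact: smooth_on_at.
have sT a' : smooth_on U (fun q => tder (gamma (X a' q)) (fun w => S w q) s).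
  by apply: (smooth_tder s (A := fun c e q => gamma (X a' q) c e)) => // c e; exact: smooth_gamma.
(* The outer derivative also treats the letter b' as a tensor slot, which gives the sum over d. *)
have expand a' b' : cov_deriv (cov_deriv S) (a' :: b' :: s) p =
    X a' p (fun q => X b' q (S s))
    - tder (fun c e => X a' p (fun q => gamma (X b' q) c e)) (fun w => S w p) s
    - tder (gamma (X b' p)) (fun w => X a' p (S w)) s
    - \sum_d gamma (X a' p) b' d * (X d p (S s) - tder (gamma (X d p)) (fun w => S w p) s)
    - tder (gamma (X a' p)) (fun w => X b' p (S w)) s
    + tder (gamma (X a' p)) (tder (gamma (X b' p)) (fun w => S w p)) s.
  rewrite /= tangentB; [|by apply: at_; apply: smooth_vfieldE|by apply: at_].
  rewrite (tangent_tder _ s Up (A := fun c e q => gamma (X b' q) c e)) //; last first.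
    by move=> c e; exact: smooth_gamma.
  have -> : tder (gamma (X a' p))
      (fun w => X b' p (S w) - tder (gamma (X b' p)) (fun w0 => S w0 p) w) s
     = tder (gamma (X a' p)) (fun w => X b' p (S w)) s
       - tder (gamma (X a' p)) (tder (gamma (X b' p)) (fun w => S w p)) s.
    rewrite -mulN1r -tderZ -tderD; apply: eq_tder => // w; by rewrite mulN1r.
  by ring.
rewrite !expand.
have comm := tder_comm (gamma (X a p)) (gamma (X b p)) (fun w => S w p) s.
have tors := frame_torsion a b Up (at_ _ (sS s)).
have split_sum a' b' :
   \sum_d gamma (X a' p) b' d * (X d p (S s) - tder (gamma (X d p)) (fun w => S w p) s)
   = \sum_d gamma (X a' p) b' d * X d p (S s)
     - tder (fun c e => \sum_d gamma (X a' p) b' d * gamma (X d p) c e) (fun w => S w p) s.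
  rewrite tder_suml -sumrB; apply: eq_bigr => d _.
  by rewrite tderZl mulrBr.
have tors' : \sum_d (gamma (X a p) b d - gamma (X b p) a d) * X d p (S s) =
   \sum_d gamma (X a p) b d * X d p (S s) - \sum_d gamma (X b p) a d * X d p (S s).
  by rewrite -sumrB; apply: eq_bigr => d _; rewrite mulrBl.
rewrite !split_sum.
(* Entry by entry, this equates two evaluations of one curvature component: K times [rot], and the
   structure equation. *)
have curv : K * tder (rot R a b) (fun w => S w p) s =
   - tder (fun c e => X a p (fun q => gamma (X b q) c e)) (fun w => S w p) s
   + tder (fun c e => X b p (fun q => gamma (X a q) c e)) (fun w => S w p) s
   + tder (fun c g => \sum_d (gamma (X a p) c d * gamma (X b p) d g
                              - gamma (X b p) c d * gamma (X a p) d g))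
       (fun w => S w p) s
   + tder (fun c e => \sum_d gamma (X a p) b d * gamma (X d p) c e) (fun w => S w p) s
   - tder (fun c e => \sum_d gamma (X b p) a d * gamma (X d p) c e) (fun w => S w p) s.
  rewrite -[- tder _ _ _]mulN1r -[- tder _ _ s in X in _ = _ + X]mulN1r -!tderZl -!tderDl.
  apply: eq_tder => // c e.
  have := frame_curvature a b c e Up; rewrite frame_curvature_gamma //.
  have -> : \sum_d (gamma (X a p) b d - gamma (X b p) a d) * gamma (X d p) c e =
     \sum_d gamma (X a p) b d * gamma (X d p) c e - \sum_d gamma (X b p) a d * gamma (X d p) c e.
    by rewrite -sumrB; apply: eq_bigr => d _; rewrite mulrBl.
  lra.
lra.
Qed.

Section Iterated.
Variables (h : M -> R) (sh : smooth_on U h).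

(* Only the components on words of length m are those of the m-th covariant
   derivative of h; shorter words give 0 and longer ones are meaningless. *)
Definition frame_nabla m : seq 'I_n -> M -> R := iter m cov_deriv (fun=> h).

Lemma smooth_frame_nabla m w : smooth_on U (frame_nabla m w).
Proof. by elim: m w => [|m IH] w //=; exact: smooth_cov_deriv. Qed.

(** The Ricci identity is differentiated along the prefix: [rot a b] has constant entries in the
    frame, so the derivative along [X c] passes through it, and [tder_swap] takes care of the
    connection terms. *)
Lemma frame_nabla_swap u m a b s p : U p ->
  frame_nabla (size u + m.+2) (u ++ a :: b :: s) p
  - frame_nabla (size u + m.+2) (u ++ b :: a :: s) p =
  K * tder (rot R a b) (fun w => frame_nabla (size u + m) (u ++ w) p) s.
Proof.
(* Induction on the length of the prefix, because the connection terms change its letters. *)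
have [i su] : exists i, size u = i by exists (size u).
rewrite su; elim: i u su a b s p => [|i IH] u su a b s p Up.
  by rewrite (size0nil su); apply: ricci_identity => // w; exact: smooth_frame_nabla.
case: u su => // c u [su].
have sH := smooth_frame_nabla.
have at_ f : smooth_on U f -> smooth_at p f by exact: smooth_on_at.
have hS k w : frame_nabla k.+1 (c :: w) p =
  X c p (frame_nabla k w) - tder (gamma (X c p)) (fun w => frame_nabla k w p) w by [].
rewrite !addSn !cat_cons !hS.
have -> : tder (rot R a b) (fun w => frame_nabla (i + m).+1 ((c :: u) ++ w) p) s =
    tder (rot R a b) (fun w => X c p (frame_nabla (i + m) (u ++ w))) s -
    tder (rot R a b)
      (fun w => tder (gamma (X c p)) (fun w0 => frame_nabla (i + m) w0 p) (u ++ w)) s.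
  by rewrite -[X in _ = _ + X]mulN1r -tderZ -tderD; apply: eq_tder => // w; rewrite mulN1r.
rewrite mulrBr -(tder_swap (S := fun w => frame_nabla (i + m.+2) w p)); last 2 first.
- by move=> c' e; exact: gammaN.
- by move=> u' a' b' s' su'; apply: IH; rewrite // su' su.
have -> : K * tder (rot R a b) (fun w => X c p (frame_nabla (i + m) (u ++ w))) s =
    X c p (frame_nabla (i + m.+2) (u ++ a :: b :: s))
    - X c p (frame_nabla (i + m.+2) (u ++ b :: a :: s)).
  rewrite -tangentB; try exact: at_.
  have sT : smooth_on U (fun q => tder (rot R a b) (fun w => frame_nabla (i + m) (u ++ w) q) s).
    apply: (smooth_tder s (A := fun c e q => rot R a b c e)
      (S := fun w => frame_nabla (i + m) (u ++ w))) => //.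
    by move=> *; exact: smooth_on_cst.
  (* Under [X c] the induction hypothesis is needed as an equality of functions on U, not only at
     p. *)
  rewrite -[RHS](tangent_local _ oU Up (f := fun q =>
    K * tder (rot R a b) (fun w => frame_nabla (i + m) (u ++ w) q) s)).
  - rewrite tangentZ; last exact: at_.
    rewrite (tangent_tder (X c p) s Up (A := fun c e q => rot R a b c e)
      (S := fun w => frame_nabla (i + m) (u ++ w))) //.
      congr (_ * _); rewrite -[LHS]add0r; congr (_ + _).
      rewrite -(tder0l (fun w => frame_nabla (i + m) (u ++ w) p) s).
      by apply: eq_tder => // c' e; rewrite tangent_cst.
    by move=> *; exact: smooth_on_cst.
  - by apply: smooth_on_mul => //; exact: smooth_on_cst.
  - by move=> q Uq; rewrite IH.
by ring.
Qed.

End Iterated.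
End Frame.

(** * Iterated covariant derivatives of arbitrary fields as contractions of frame components *)

Lemma sum_Complex (R : rcfType) (I : Type) (r : seq I) (a b : I -> R) :
  \sum_(i <- r) Complex (a i) (b i) = Complex (\sum_(i <- r) a i) (\sum_(i <- r) b i).
Proof. by elim: r => [|i r IH]; rewrite ?big_nil // !big_cons IH. Qed.

Section Components.
Variables (R : realType) (n : nat) (M : riemannianManifold R n).
Variables (nabla : connection M) (U : set M) (X : 'I_n -> vfield M).
Hypotheses (nabla_LC : levi_civita nabla) (oU : open U) (X_frame : orthonormal_frame U X).

Let sX i : smooth_vfield U (X i).
Proof. by have [H _ _] := X_frame; exact: H. Qed.

(** Tangent vectors are real derivations, and [cderiv] acts on real and imaginary parts separately;
    the computation is carried out on each part. *)
Fixpoint real_nabla_iter (h : M -> R) (m : nat) : ('I_m -> vfield M) -> M -> R :=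
  match m with
  | 0 => fun _ => h
  | r.+1 => fun (Z : 'I_r.+1 -> vfield M) p =>
      let Z1 := Z ord0 in
      let Y : 'I_r -> vfield M := fun j : 'I_r => Z (lift ord0 j) in
      Z1 p (real_nabla_iter h Y) -
      \sum_(i < r) real_nabla_iter h
        (fun j : 'I_r => if j == i then covd nabla Z1 (Y j) else Y j) p
  end.

Lemma nabla_iterE (f : M -> R[i]) m (Z : 'I_m -> vfield M) :
  nabla_iter nabla f Z = fun p =>
    Complex (real_nabla_iter (fun q => complex.Re (f q)) Z p)
            (real_nabla_iter (fun q => complex.Im (f q)) Z p).
Proof.
elim: m Z => [|m IH] Z; apply/funext => p /=; first by case: (f p).
rewrite IH /cderiv /=.
under eq_bigr do rewrite IH.
by rewrite sum_Complex.
Qed.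

Definition coefs q m (y : 'I_m -> tangent q) (j : 'I_m) (d : 'I_n) : R :=
  metric (y j) (X d q).

Lemma smooth_contract m (Y : 'I_m -> vfield M) (S : seq 'I_n -> M -> R) :
  (forall j, smooth_vfield U (Y j)) -> (forall w, smooth_on U (S w)) ->
  smooth_on U (fun q => contract (coefs (fun j => Y j q)) (fun w => S w q)).
Proof.
elim: m Y S => [|m IH] Y S sY sS //=.
apply: smooth_on_sum => // d; apply: smooth_on_mul => //.
  by apply: metric_smooth; [|exact: sY|exact: sX].
by apply: (IH (fun j => Y (lift ord0 j)) (fun w => S (d :: w))).
Qed.

(** Leibniz rule for a full contraction. Metric compatibility splits the derivative of each
    coefficient; the part falling on the frame field moves onto the components of S by skewness of
    [gamma]. *)
Lemma tangent_contract m (Y : 'I_m -> vfield M) (S : seq 'I_n -> M -> R) q (v : tangent q) :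
  U q -> (forall j, smooth_vfield U (Y j)) -> (forall w, smooth_on U (S w)) ->
  v (fun r => contract (coefs (fun j => Y j r)) (fun w => S w r)) =
  \sum_(i < m) contract (coefs (fun j => if j == i then nabla v (Y j) else Y j q)) (fun w => S w q)
  + contract (coefs (fun j => Y j q))
      (fun w => v (S w) - tder (gamma nabla X v) (fun w' => S w' q) w).
Proof.
move=> Uq; elim: m Y S => [|m IH] Y S sY sS; first by rewrite big_ord0 /= subr0 add0r.
have at_ f : smooth_on U f -> smooth_at q f by exact: smooth_on_at.
have sYX d : smooth_on U (fun r => metric (Y ord0 r) (X d r)).
  by apply: metric_smooth; [|exact: sY|exact: sX].
pose Y' j := Y (lift ord0 j).
have sC d : smooth_on U (fun r => contract (coefs (fun j => Y' j r)) (fun w => S (d :: w) r)).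
  by apply: (smooth_contract (S := fun w => S (d :: w))) => // j; exact: sY.
transitivity (\sum_d v (fun r => metric (Y ord0 r) (X d r) *
    contract (coefs (fun j => Y' j r)) (fun w => S (d :: w) r))).
  by rewrite -(tangent_sum _ _ oU Uq) // => d; exact: smooth_on_mul.
pose C d := contract (coefs (fun j => Y' j q)) (fun w => S (d :: w) q).
have vd d : v (fun r => metric (Y ord0 r) (X d r) *
    contract (coefs (fun j => Y' j r)) (fun w => S (d :: w) r)) =
  metric (nabla v (Y ord0)) (X d q) * C d + metric (Y ord0 q) (nabla v (X d)) * C d
  + metric (Y ord0 q) (X d q) *
     (\sum_(i < m) contract (coefs (fun j => if j == i then nabla v (Y' j) else Y' j q))
        (fun w => S (d :: w) q))
  + metric (Y ord0 q) (X d q) *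
     contract (coefs (fun j => Y' j q))
       (fun w => v (S (d :: w)) - tder (gamma nabla X v) (fun w' => S (d :: w') q) w).
  rewrite tangentM; [|exact: at_|exact: at_].
  rewrite (nabla_metric nabla_LC oU) // (IH Y' (fun w => S (d :: w))) //;
    last by move=> j; exact: sY.
  by rewrite /C; ring.
under eq_bigr do rewrite vd.
rewrite !big_split /= big_ord_recl -!addrA; congr (_ + _).
rewrite addrCA; congr (_ + _).
  under eq_bigr do rewrite mulr_sumr.
  rewrite exchange_big; apply: eq_bigr => i _; apply: eq_bigr => d _ /=.
  by congr (_ * _).
pose Y0 d := metric (Y ord0 q) (X d q).
have skew : \sum_d metric (Y ord0 q) (nabla v (X d)) * C d =
    - \sum_d Y0 d * \sum_e gamma nabla X v d e * C e.
  under [in RHS]eq_bigr do rewrite mulr_sumr.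
  rewrite exchange_big -sumrN; apply: eq_bigr => d _.
  rewrite (metric_expand X_frame (Y ord0 q) _ Uq) mulr_suml -sumrN; apply: eq_bigr => e _.
  by rewrite -/(gamma nabla X v d e) (gammaN nabla_LC oU X_frame) // /Y0; ring.
rewrite skew -sumrN -big_split; apply: eq_bigr => d _ /=.
rewrite -/(Y0 d) -mulrN -mulrDr; congr (_ * _).
have -> : \sum_e gamma nabla X v d e * C e =
    contract (coefs (fun j => Y' j q)) (fun w => \sum_e gamma nabla X v d e * S (e :: w) q).
  by rewrite contract_sum; apply: eq_bigr => e _; rewrite contractZ.
rewrite -mulN1r -contractZ -contractD; apply: eq_contract => // w; ring.
Qed.

(** Stated for arbitrary smooth fields because the recursion evaluates lower derivatives on
    [covd nabla (Z ord0) (Y j)]. Subtracting these terms from the Leibniz rule leaves exactly the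
    contraction of [cov_deriv]. *)
Lemma real_nabla_iterE (h : M -> R) m (Z : 'I_m -> vfield M) q :
  smooth_on U h -> U q -> (forall j, smooth_vfield U (Z j)) ->
  real_nabla_iter h Z q =
  contract (coefs (fun j => Z j q)) (fun w => frame_nabla nabla X h m w q).
Proof.
move=> sh; elim: m Z q => [|m IH] Z q Uq sZ //.
have sH := smooth_frame_nabla nabla_LC oU X_frame sh.
pose Y j := Z (lift ord0 j).
have sY j : smooth_vfield U (Y j) by exact: sZ.
have -> : real_nabla_iter h Z q = Z ord0 q (real_nabla_iter h Y) -
   \sum_(i < m) real_nabla_iter h
     (fun j => if j == i then covd nabla (Z ord0) (Y j) else Y j) q by [].
rewrite -(tangent_local (Z ord0 q) oU Uq (smooth_contract sY (sH m))); last first.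
  by move=> r Ur; rewrite IH.
rewrite tangent_contract // addrAC -sumrB big1 ?add0r; last first.
  move=> i _; rewrite IH //; last first.
    by move=> j; case: eqP => _; [apply: smooth_covd|].
  apply/eqP; rewrite subr_eq0; apply/eqP; apply: eq_contract => // j d.
  by rewrite /coefs; case: eqP.
transitivity (contract (coefs (fun j => Y j q))
   (fun w => \sum_a metric (Z ord0 q) (X a q) *
      cov_deriv nabla X (frame_nabla nabla X h m) (a :: w) q)).
  apply: eq_contract => // w /=.
  rewrite {1}(frame_expand X_frame (Z ord0 q) Uq) tangent_sumE.
  have -> : tder (gamma nabla X (Z ord0 q)) (fun w' => frame_nabla nabla X h m w' q) w =
     \sum_a metric (Z ord0 q) (X a q) *
       tder (gamma nabla X (X a q)) (fun w' => frame_nabla nabla X h m w' q) w.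
    under [RHS]eq_bigr do rewrite -tderZl; rewrite -tder_suml.
    by apply: eq_tder => // c e; apply: (gamma_sum nabla_LC oU X_frame).
  by rewrite -sumrB; apply: eq_bigr => a _; rewrite mulrBr.
by rewrite contract_sum /=; apply: eq_bigr => a _; rewrite contractZ.
Qed.

Lemma real_nabla_iter_frame (h : M -> R) m (w : 'I_m -> 'I_n) q :
  smooth_on U h -> U q ->
  real_nabla_iter h (fun j => X (w j)) q =
  frame_nabla nabla X h m [seq w j | j <- enum 'I_m] q.
Proof.
move=> sh Uq; rewrite real_nabla_iterE //.
rewrite -(contract_delta w (fun w => frame_nabla nabla X h m w q)).
apply: eq_contract => // j d; have [_ H _] := X_frame; exact: H.
Qed.

End Components.

(** * Expansion of the permuted tensor into a signed sum over valuations *)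

Lemma half_ord_proof k (t : 'I_(k * 2)) : (t./2 < k)%N.
Proof. by rewrite ltn_half_double -muln2. Qed.

(** Slots 2t and 2t+1 of the power of theta belong to its factor t and share one index. *)
Definition half_ord k (t : 'I_(k * 2)) : 'I_k := Ordinal (half_ord_proof t).

Lemma count_half k x : (\sum_(t < k * 2) (t./2 == x) = (x < k) * 2)%N.
Proof.
elim: k => [|k IH]; first by rewrite big_ord0.
rewrite -(big_mkord xpredT (fun t => ((t./2 == x) : nat))) mulSn add2n !big_nat_recr //=.
rewrite big_mkord IH uphalf_half !muln2 odd_double doubleK add0n ltnS.
by case: (ltngtP k x).
Qed.

Section TensorSums.
Variables (R : realType) (n : nat) (M : riemannianManifold R n) (X : 'I_n -> vfield M).

Definition ffun_cons (T : finType) k (p : T * {ffun 'I_k -> T}) : {ffun 'I_k.+1 -> T} :=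
  [ffun t => if unlift ord0 t is Some t' then p.2 t' else p.1].

Lemma ffun_cons_bij (T : finType) k : bijective (@ffun_cons T k).
Proof.
exists (fun f : {ffun 'I_k.+1 -> T} => (f ord0, [ffun t => f (lift ord0 t)])) => [[a f]|f].
  rewrite ffunE unlift_none /=; congr (_, _); apply/ffunP => t.
  by rewrite !ffunE liftK.
apply/ffunP => t; rewrite !ffunE; case: unliftP => [t' ->|->] //=.
by rewrite ffunE.
Qed.

(** Tensors are formal sums, so this is an identity of lists, valid for an arbitrary function
    [G]. *)
Lemma sum_tensor_mul r s (S : tensor M r) (T : tensor M s) (G : ('I_(r + s) -> vfield M) -> R[i]) :
  \sum_(a <- tensor_mul S T) a.1 * G a.2 =
  \sum_(a <- S) a.1 * \sum_(b <- T) b.1 *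
     G (fun j => match fintype.split j with inl i => a.2 i | inr i => b.2 i end).
Proof.
rewrite /tensor_mul big_allpairs_dep; apply: eq_bigr => a _.
by rewrite mulr_sumr; apply: eq_bigr => b _; rewrite mulrA.
Qed.

Lemma sum_theta_exp k (G : ('I_(k * 2) -> vfield M) -> R[i]) :
  \sum_(a <- tensor_exp (theta X) k) a.1 * G a.2 =
  \sum_(i : {ffun 'I_k -> 'I_n}) G (fun t => X (i (half_ord t))).
Proof.
elim: k G => [|k IH] G.
  rewrite big_seq1 mul1r (big_pred1 (ffun0 (card_ord 0))); last first.
    by move=> i; apply/esym/eqP/ffunP => -[].
  by congr G; apply/funext => -[].
etransitivity; first exact: (sum_tensor_mul (theta X) (tensor_exp (theta X) k) G).
rewrite big_map big_enum (reindex _ (onW_bij _ (ffun_cons_bij _ k))) /=.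
rewrite -(pair_big xpredT xpredT (fun a f => G (fun t => X (ffun_cons (a, f) (half_ord t))))).
apply: eq_bigr => a _; rewrite mul1r.
rewrite (IH (fun b => G (fun j => match fintype.split j with inl _ => X a | inr i => b i end))).
apply: eq_bigr => f _; congr G; apply/funext => t.
case: split_ordP => t' ->; rewrite ffunE.
  rewrite (_ : half_ord _ = ord0) ?unlift_none //.
  by apply: val_inj; case: t' => -[|[|]].
rewrite (_ : half_ord _ = lift ord0 (half_ord t')) ?liftK //.
by apply: val_inj.
Qed.

Lemma sum_Lambda (G : ('I_n -> vfield M) -> R[i]) :
  \sum_(a <- Lambda X) a.1 * G a.2 =
  \sum_(mu : 'S_n) (-1) ^+ odd_perm mu * G (fun y => X (mu y)).
Proof. by rewrite big_map big_enum. Qed.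

Definition var_of k (j : 'I_(k * 2 + n)) : 'I_k + 'I_n :=
  match fintype.split j with inl t => inl (half_ord t) | inr y => inr y end.

Lemma sum_theta_Lambda k (sigma : 'S_(k * 2 + n)) (G : ('I_(k * 2 + n) -> vfield M) -> R[i]) :
  \sum_(a <- tensor_perm sigma (tensor_mul (tensor_exp (theta X) k) (Lambda X))) a.1 * G a.2 =
  \sum_(i : {ffun 'I_k -> 'I_n}) \sum_(mu : 'S_n) (-1) ^+ odd_perm mu *
    G (fun j => X (valuation i mu (var_of ((sigma^-1)%g j)))).
Proof.
pose G1 Z := G (fun j => Z ((sigma^-1)%g j)).
transitivity (\sum_(a <- tensor_mul (tensor_exp (theta X) k) (Lambda X)) a.1 * G1 a.2).
  by rewrite /tensor_perm big_map.
pose G2 Y Z := G1 (fun j => match fintype.split j with inl i => Y i | inr i => Z i end).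
rewrite sum_tensor_mul (sum_theta_exp (fun Y => \sum_(b <- Lambda X) b.1 * G2 Y b.2)).
apply: eq_bigr => i _; rewrite (sum_Lambda (G2 _)); apply: eq_bigr => mu _.
rewrite /G2 /G1; congr (_ * G _); apply/funext => j.
by rewrite /var_of; case: fintype.split.
Qed.

(** Reindexing by [sigma] reduces the count to the unpermuted word, where each theta fills two slots
    and each entry of the permutation one. *)
Lemma good_word_perm_var k (sigma : 'S_(k * 2 + n)) :
  good_word [seq var_of ((sigma^-1)%g j) | j <- enum 'I_(k * 2 + n)].
Proof.
move=> x.
have -> : count_mem x [seq var_of ((sigma^-1)%g j) | j <- enum 'I_(k * 2 + n)] =
    (\sum_(t < k * 2) (inl (half_ord t) == x) + \sum_(y < n) (inr y == x))%N.
  transitivity (\sum_(j < k * 2 + n) (var_of ((sigma^-1)%g j) == x))%N.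
    by rewrite count_map -sumn_count sumnE big_map big_enum.
  rewrite (reindex_inj (perm_inj (s := sigma))) big_split_ord /=.
  congr (_ + _)%N; apply: eq_bigr => t _; rewrite permK /var_of.
    by rewrite (unsplitK (inl t)).
  by rewrite (unsplitK (inr t)).
case: x => x.
  rewrite [X in (_ + X)%N]big1 // addn0 (eq_bigr (fun t : 'I_(k * 2) => (t./2 == x) : nat)) //.
  by rewrite count_half ltn_ord.
rewrite big1 // add0n (bigD1 x) //= eqxx big1 // => y yx.
by rewrite -[_ == _]/(y == x) (negbTE yx).
Qed.

End TensorSums.

Theorem theorem4p4 (R : realType) (n : nat) (M : riemannianManifold R n)
  (nabla : connection M) (K : R) (U : set M) (X : 'I_n -> vfield M)
  (f : M -> R[i]) (lambda : R[i])
  (n_ge2 : (2 <= n)%N)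
  (M_connected : connected [set: M])
  (M_complete : complete_manifold M)
  (nabla_LC : levi_civita nabla)
  (M_curvature : constant_sectional_curvature nabla K)
  (K_neq0 : K <> 0)
  (U_open : open U)
  (X_frame : orthonormal_frame U X)
  (f_smooth : csmooth_on U f)
  (f_eigen : forall p, U p -> laplacian nabla X f p = - lambda * f p)
  (k : nat) (sigma : 'S_(k * 2 + n)) (p : M) (Up : U p) :
  nabla_tensor nabla f
    (tensor_perm sigma (tensor_mul (tensor_exp (theta X) k) (Lambda X))) p = 0.
Proof.
have [sre sim] := f_smooth.
pose phi := [seq var_of ((sigma^-1)%g j) | j <- enum 'I_(k * 2 + n)].
have sz : size phi = (k * 2 + n)%N by rewrite size_map size_enum_ord.
(* The order of differentiation is read off from the length of the word, so that one function
   carries all the orders met in the induction. *)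
pose T h w := frame_nabla nabla X h (size w) w p.
have T0 h : smooth_on U h -> wpair (T h) phi = 0.
  move=> sh; apply: (wpair0 n_ge2 (K := K)); last exact: good_word_perm_var.
  move=> u a b s; rewrite /T !size_cat /=.
  rewrite (frame_nabla_swap nabla_LC U_open X_frame M_curvature K_neq0 sh) //.
  (* The curvature action preserves length, so the order stays equal to the length of each word that
     occurs. *)
  by congr (_ * _); apply: eq_tder_size => w sw; rewrite size_cat sw.
rewrite /nabla_tensor (sum_theta_Lambda X sigma (fun Z => nabla_iter nabla f Z p)).
(* The signs are real, so the complex sum splits into the pairings of the real and imaginary
   parts. *)
have term (i : {ffun 'I_k -> 'I_n}) (mu : 'S_n) :
  (-1) ^+ odd_perm mu * nabla_iter nabla f
    (fun j => X (valuation i mu (var_of ((sigma^-1)%g j)))) p =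
  Complex ((-1) ^+ odd_perm mu * T (fun q => complex.Re (f q)) (map (valuation i mu) phi))
          ((-1) ^+ odd_perm mu * T (fun q => complex.Im (f q)) (map (valuation i mu) phi)).
  rewrite nabla_iterE !(real_nabla_iter_frame nabla_LC U_open X_frame) //.
  rewrite /T (size_map _ phi) sz /phi -map_comp.
  by case: (odd_perm mu); rewrite ?expr0 ?expr1 ?mul1r ?mulN1r.
under eq_bigr do (under eq_bigr do rewrite term; rewrite sum_Complex).
rewrite sum_Complex; exact: (congr2 (@Complex R) (T0 _ sre) (T0 _ sim)).
Qed.
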